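(* Clique-Identification and Cluster-Identification each admit a kernel with $\mathcal{O}(p^4)$ vertices when parameterized by $p=n-k$, where $n$ is the number of vertices of the input graph and $k$ the input integer.
   Context: All graphs are finite, simple and undirected. An identification of two distinct vertices $u,v$ replaces them with a new vertex adjacent to every vertex of $(N(u)\cup N(v))\setminus\{u,v\}$. A cluster graph is a graph every connected component of which is a complete graph. Clique-Identification (resp. Cluster-Identification) takes as input a graph $G$ and an integer $k\ge 0$ and asks whether $G$ can be transformed into a complete graph (resp. a cluster graph) by at most $k$ identifications. A kernel for parameter $p$ is a polynomial-time algorithm mapping each instance to an equivalent instance of the same problem whose number of vertices and whose parameter value are bounded by a function of $p$. *)

(* Defs.v *)
From mathcomp Require Import all_boot all_order all_algebra.

Set Implicit Arguments.
Unset Strict Implicit.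
Unset Printing Implicit Defensive.

(** * Graphs and identifications *)

Record sgraph (V : finType) := SGraph {
  adj :> rel V;
  adj_sym : symmetric adj;
  adj_irr : irreflexive adj
}.

Section Identification.

Variables (V : finType) (G : sgraph V) (u v : V).

(* [None] is the new vertex, [Some x] an old vertex other than [u] and [v]. *)
Definition ident_vertex : finType := option {x : V | (x != u) && (x != v)}.

Definition ident_rel (a b : ident_vertex) : bool :=
  match a, b with
  | Some x, Some y => adj G (val x) (val y)
  | Some x, None | None, Some x => adj G u (val x) || adj G v (val x)
  | None, None => false
  end.

Lemma ident_sym : symmetric ident_rel.
Proof. by case=> [x|] [y|] //=; rewrite adj_sym. Qed.

Lemma ident_irr : irreflexive ident_rel.
Proof. by case=> [x|] //=; rewrite adj_irr. Qed.

Definition ident : sgraph ident_vertex := SGraph ident_sym ident_irr.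

End Identification.

Definition graph_class := forall V : finType, sgraph V -> Prop.

(* [G] can be turned into a member of [P] by at most [k] identifications. *)
Fixpoint identifiable (P : graph_class) (k : nat) (V : finType) (G : sgraph V)
    {struct k} : Prop :=
  P V G \/
  match k with
  | 0 => False
  | j.+1 => exists u v : V, u != v /\ identifiable P j (ident G u v)
  end.

Definition complete_graph : graph_class :=
  fun V G => forall u v : V, u != v -> adj G u v.

Definition cluster_graph : graph_class :=
  fun V G => forall x u v : V,
    connect (adj G) x u -> connect (adj G) x v -> u != v -> adj G u v.

(** * Problem instances *)

Record instance := Instance {
  order : nat;
  graph : sgraph 'I_order;
  budget : nat
}.

Definition clique_identification (x : instance) : Prop :=
  identifiable complete_graph (budget x) (graph x).

Definition cluster_identification (x : instance) : Prop :=
  identifiable cluster_graph (budget x) (graph x).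

(* An integer, since the budget may exceed the number of vertices. *)
Definition order_minus_budget (x : instance) : int :=
  ((order x)%:Z - (budget x)%:Z)%R.

(* The number of vertices, the budget, and the adjacency matrix by rows. *)
Definition encode (x : instance) : seq nat :=
  [:: order x, budget x &
      [seq (adj (graph x) u v : nat) | u <- enum 'I_(order x),
                                       v <- enum 'I_(order x)]].

(** * Polynomial time *)

(* Random access machine over the natural numbers, with structured control
   flow, at unit cost. The arithmetic is addition and truncated subtraction
   only: one step lengthens the longest number by at most one bit, so that
   polynomial time is the same here as on Turing machines (this would fail with
   unit-cost multiplication). *)
Inductive ram :=
  | Const of nat & nat         (* r_i := n *)
  | Add of nat & nat & nat     (* r_i := r_j + r_k *)
  | Sub of nat & nat & nat     (* r_i := r_j - r_k *)
  | Read of nat & nat          (* r_i := mem[r_j] *)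
  | Write of nat & nat         (* mem[r_i] := r_j *)
  | Skip
  | Seq of ram & ram
  | If of nat & ram & ram      (* first branch when r_i is nonzero *)
  | While of nat & ram.        (* loop as long as r_i is nonzero *)

Record ram_state := RamState { reg : nat -> nat; mem : nat -> nat }.

Definition upd (f : nat -> nat) (i a : nat) : nat -> nat :=
  fun j => if j == i then a else f j.

Definition set_reg (s : ram_state) (i a : nat) : ram_state :=
  RamState (upd (reg s) i a) (mem s).

Definition set_mem (s : ram_state) (i a : nat) : ram_state :=
  RamState (reg s) (upd (mem s) i a).

(* [ram_exec c s t s']: started in [s], [c] halts in [s'] after [t] steps. *)
Inductive ram_exec : ram -> ram_state -> nat -> ram_state -> Prop :=
  | ExecConst i n s : ram_exec (Const i n) s 1 (set_reg s i n)
  | ExecAdd i j k s :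
      ram_exec (Add i j k) s 1 (set_reg s i (reg s j + reg s k))
  | ExecSub i j k s :
      ram_exec (Sub i j k) s 1 (set_reg s i (reg s j - reg s k))
  | ExecRead i j s : ram_exec (Read i j) s 1 (set_reg s i (mem s (reg s j)))
  | ExecWrite i j s : ram_exec (Write i j) s 1 (set_mem s (reg s i) (reg s j))
  | ExecSkip s : ram_exec Skip s 1 s
  | ExecSeq c1 c2 s1 s2 s3 t1 t2 :
      ram_exec c1 s1 t1 s2 -> ram_exec c2 s2 t2 s3 ->
      ram_exec (Seq c1 c2) s1 (t1 + t2) s3
  | ExecIfTrue i c1 c2 s s' t :
      reg s i != 0 -> ram_exec c1 s t s' -> ram_exec (If i c1 c2) s t.+1 s'
  | ExecIfFalse i c1 c2 s s' t :
      reg s i = 0 -> ram_exec c2 s t s' -> ram_exec (If i c1 c2) s t.+1 s'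
  | ExecWhileStop i c s : reg s i = 0 -> ram_exec (While i c) s 1 s
  | ExecWhileStep i c s1 s2 s3 t1 t2 :
      reg s1 i != 0 -> ram_exec c s1 t1 s2 -> ram_exec (While i c) s2 t2 s3 ->
      ram_exec (While i c) s1 (t1 + t2).+1 s3.

(* A word [w] is read and written in the memory cells [0], ..., [size w - 1],
   its length in register [0]; everything else is initially zero. *)
Definition ram_input (w : seq nat) : ram_state :=
  RamState (upd (fun _ => 0) 0 (size w)) (nth 0 w).

Definition ram_output (s : ram_state) (w : seq nat) : Prop :=
  reg s 0 = size w /\ forall i, i < size w -> mem s i = nth 0 w i.

(* Total number of binary digits. *)
Definition bit_size (w : seq nat) : nat :=
  \sum_(a <- w) (trunc_log 2 a).+1.

Definition poly_time (f : instance -> instance) : Prop :=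
  exists (c : ram) (a d : nat), forall x : instance,
    exists (t : nat) (s : ram_state),
      [/\ ram_exec c (ram_input (encode x)) t s,
          ram_output s (encode (f x))
        & t <= a * bit_size (encode x) ^ d].

(** * Kernels *)

(* A kernel with O(h(p)) vertices for the parameter [p = par x]. The successor
   in the vertex bound only matters when [h `|par x|] is zero, where it allows
   constant size. *)
Definition admits_kernel (L : instance -> Prop) (par : instance -> int)
    (h : nat -> nat) : Prop :=
  exists f : instance -> instance,
    [/\ poly_time f,
        forall x, L x <-> L (f x),
        exists c : nat, forall x, order (f x) <= c * (h `|par x|%N).+1
      & exists g : int -> nat, forall x, `|par (f x)|%N <= g (par x)].

(* Main.v *)
From mathcomp Require Import all_boot all_order all_algebra zify.
Require Import Defs.

Set Implicit Arguments.
Unset Strict Implicit.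
Unset Printing Implicit Defensive.

Import Order.TTheory.

(** Put p = n - k. At most k identifications reach a complete (cluster) graph iff the
    vertices can be partitioned into exactly p parts such that any two parts (any two
    parts of the same component of the quotient) are joined by an edge. Only O(p^2)
    edges witness such a partition.

    Greedily choose a subgraph H of maximum degree at most D = 4p^2, stopping at 16p^4
    arcs. If H reaches that size, its edges can be made to join all pairs of p parts, and
    the instance is positive. Otherwise every edge outside H has an endpoint of degree D
    in H, so each witness edge can be rerouted to a fresh H-neighbour of that endpoint,
    within the same component: partitions only need the edges of H. Hence every vertex
    outside H can be merged into a neighbour, which changes neither the components nor
    H. For cluster graphs, p isolated vertices already give a solution, so only the first
    p of them are kept. One map serves both problems. A program over n x n tables whose
    loops all run over the vertices computes it, which bounds its running time by a
    polynomial. *)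

(** * Sums, cardinals and folds *)

Lemma nat_of_bool_neq0 (b : bool) : ((b : nat) != 0) = b.
Proof. by case: b. Qed.

Lemma sum_nat_of_bool (T : finType) (P : pred T) : \sum_x (P x : nat) = #|P|.
Proof.
rewrite -sum1_card [RHS]big_mkcond; apply: eq_bigr => x _.
by rewrite unfold_in; case: (P x).
Qed.

Lemma card_leq_inj (T : finType) (A : {set T}) (h : T -> nat) p :
  {in A &, injective h} -> {in A, forall x, h x < p} -> #|A| <= p.
Proof.
move=> h_inj h_lt; rewrite cardE -(size_map h) -(size_iota 0 p); apply: uniq_leq_size.
  by rewrite map_inj_in_uniq ?enum_uniq // => x y; rewrite !mem_enum; apply: h_inj.
by move=> _ /mapP[x + ->]; rewrite mem_enum mem_iota => /h_lt.
Qed.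

Lemma eqn_mulD_small m a b c d : b < m -> d < m ->
  (a * m + b == c * m + d) = (a == c) && (b == d).
Proof.
move=> bm dm; apply/eqP/andP => [eq_abcd|[/eqP-> /eqP->] //].
have m_gt0 : 0 < m by apply: leq_ltn_trans bm.
have /eqP := congr1 (divn^~ m) eq_abcd; have /eqP := congr1 (modn^~ m) eq_abcd.
by rewrite !modnMDl !modn_small // !divnMDl // !divn_small // !addn0.
Qed.

Lemma nth_allpairs (A B C : Type) (f : A -> B -> C) (s : seq A) (t : seq B) a0 b0 c0 i j :
  i < size s -> j < size t ->
  nth c0 [seq f a b | a <- s, b <- t] (i * size t + j) = f (nth a0 s i) (nth b0 t j).
Proof.
move=> + jt; elim: s i => //= a s IH [_|i] /=.
  by rewrite nth_cat size_map mul0n jt (nth_map b0).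
rewrite ltnS => lt_i; rewrite nth_cat size_map mulSn -addnA ltnNge leq_addr /=.
by rewrite addKn IH.
Qed.

Lemma iteri_foldl n (A : Type) (F : nat -> A -> A) a :
  iteri n F a = foldl (fun a (i : 'I_n) => F i a) a (enum 'I_n).
Proof.
have -> s b : foldl (fun a (i : 'I_n) => F i a) b s =
    foldl (fun a i => F i a) b (map val s).
  by elim: s b => //= i s IH b.
rewrite val_enum_ord.
by elim: n => // n IH; rewrite -[in RHS]addn1 iotaD foldl_cat -IH.
Qed.

Lemma foldl_allpairs (A B C : Type) (F : A -> B * C -> A) a (s : seq B) (t : seq C) :
  foldl F a [seq (u, v) | u <- s, v <- t] =
  foldl (fun a u => foldl (fun a v => F a (u, v)) a t) a s.
Proof.
elim: s a => //= u s IH a; rewrite foldl_cat {}IH; congr foldl.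
by elim: t a => //= v t IH a.
Qed.

Lemma foldl_rel (A B C : Type) (R : A -> B -> Prop) (F : A -> C -> A) (F' : B -> C -> B)
    (s : seq C) a b :
  (forall a b c, R a b -> R (F a c) (F' b c)) -> R a b -> R (foldl F a s) (foldl F' b s).
Proof. by move=> RF; elim: s a b => //= c s IH a b ab; apply/IH/RF. Qed.

(** * Identification sequences as vertex partitions *)

Definition target (b : bool) : graph_class :=
  if b then complete_graph else cluster_graph.

(* The parts are the elements of [W]; [r] relates two parts when they lie in the
   same component of the target, so [b] forces a single component. *)
Record cluster_map (b : bool) (V W : finType) (G : sgraph V) (f : V -> W)
    (r : rel W) : Prop := ClusterMap {
  cm_equiv : equivalence_rel r;
  cm_total : b -> forall c c', r c c';
  cm_adj : forall x y, adj G x y -> r (f x) (f y);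
  cm_surj : forall c, exists x, f x = c;
  cm_edge : forall c c', c != c' -> r c c' ->
    exists x y, [/\ adj G x y, f x = c & f y = c']
}.

Section ClusterMap.

Variables (b : bool) (V W : finType) (G : sgraph V) (f : V -> W) (r : rel W).
Hypothesis cm : cluster_map b G f r.

Lemma cm_refl c : r c c.
Proof. by have [] := cm_equiv cm c c c. Qed.

Lemma cm_left_trans c c' : r c c' -> r c =1 r c'.
Proof. by move=> cc' z; have [_ ->] := cm_equiv cm c c' z. Qed.

Lemma cm_sym c c' : r c c' = r c' c.
Proof. by apply/idP/idP => /cm_left_trans <-; apply: cm_refl. Qed.

Lemma cm_trans c' c c'' : r c c' -> r c' c'' -> r c c''.
Proof. by move=> /cm_left_trans ->. Qed.

Lemma cm_connect x y : connect (adj G) x y -> r (f x) (f y).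
Proof.
move=> /connectP[s + ->]; elim: s x => [|z s IH] x /=; first by rewrite cm_refl.
by move=> /andP[/(cm_adj cm) xz /IH]; apply: cm_trans xz.
Qed.

Lemma cm_injective : injective f -> target b G.
Proof.
move=> f_inj; have edge u v : u != v -> r (f u) (f v) -> adj G u v.
  by move=> uv /(cm_edge cm)[|x [y [xy /f_inj<- /f_inj<-]]]; rewrite ?inj_eq.
rewrite /target; have := cm_total cm.
case: (b) => [total u v uv|_ x u v xu xv uv]; apply: edge => //; first exact: total.
by apply: cm_trans (cm_connect xv); rewrite cm_sym; apply: cm_connect.
Qed.

Lemma cm_eq (g : V -> W) : f =1 g -> cluster_map b G g r.
Proof.
move=> fg; split.
- exact: cm_equiv cm.
- exact: cm_total cm.
- by move=> x y; rewrite -!fg; apply: cm_adj cm x y.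
- by move=> c; have [x <-] := cm_surj cm c; exists x.
- move=> c c' cc' rcc'; have [x [y [xy <- <-]]] := cm_edge cm cc' rcc'.
  by exists x, y.
Qed.

Lemma cm_card_injective : #|V| <= #|W| -> injective f.
Proof.
move=> leVW; have leW : #|W| <= #|codom f|.
  by apply/subset_leq_card/subsetP => c _; have [x <-] := cm_surj cm c; apply: codom_f.
suff /image_injP inj : #|codom f| == #|V| by move=> x y; apply: inj.
by rewrite eqn_leq leq_image_card (leq_trans leVW).
Qed.

End ClusterMap.

Lemma target_cluster_map b (V : finType) (G : sgraph V) :
  target b G -> exists r, cluster_map b G id r.
Proof.
rewrite /target; case: b => [complG|clusterG].
  exists (fun _ _ => true); split=> // [c|c c' cc' _]; first by exists c.
  by exists c, c'; split=> //; apply: complG.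
have connC : connect_sym (adj G) by apply/sym_connect_sym/adj_sym.
exists (connect (adj G)); split=> //.
- apply/equivalence_relP; split; first exact: connect0.
  by move=> x y /(same_connect connC).
- by move=> x y; apply: connect1.
- by move=> c; exists c.
- move=> c c' cc' conn; exists c, c'; split=> //.
  by apply: (clusterG c) => //; apply: connect0.
Qed.

Record contraction (V V' : finType) (G : sgraph V) (G' : sgraph V')
    (phi : V -> V') : Prop := Contraction {
  contraction_surj : forall a, exists x, phi x = a;
  contraction_adj : forall a a', adj G' a a' <->
    a != a' /\ exists x y, [/\ adj G x y, phi x = a & phi y = a']
}.

Lemma cluster_map_contraction b (V V' W : finType) (G : sgraph V) (G' : sgraph V')
    (phi : V -> V') (f : V' -> W) r :
  contraction G G' phi -> cluster_map b G' f r <-> cluster_map b G (f \o phi) r.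
Proof.
move=> [phi_surj phi_adj]; split=> cm; (split; [exact: cm_equiv cm
  | exact: cm_total cm | | | ]).
- move=> x y xy /=; have [->|neq] := eqVneq (phi x) (phi y); first exact: cm_refl cm _.
  by apply: (cm_adj cm); apply/phi_adj; split=> //; exists x, y.
- move=> c; have [a <-] := cm_surj cm c; have [x <-] := phi_surj a.
  by exists x.
- move=> c c' cc' rcc'; have [a [a' [aa' <- <-]]] := cm_edge cm cc' rcc'.
  by have /phi_adj[_ [x [y [xy <- <-]]]] := aa'; exists x, y.
- by move=> _ _ /phi_adj[_ [x [y [xy <- <-]]]]; apply: cm_adj cm x y xy.
- by move=> c; have [x <-] := cm_surj cm c; exists (phi x).
- move=> c c' cc' rcc'; have [x [y [xy fx fy]]] := cm_edge cm cc' rcc'.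
  exists (phi x), (phi y); split=> //; apply/phi_adj; split; last by exists x, y.
  by apply: contraNneq cc' => phixy; rewrite -fx -fy /= phixy.
Qed.

Section IdentProjection.

Variables (V : finType) (G : sgraph V) (u v : V).

Definition ident_proj (x : V) : ident_vertex u v := insub x.

Lemma ident_proj_val (z : {x : V | (x != u) && (x != v)}) :
  ident_proj (val z) = Some z.
Proof. exact: valK. Qed.

Variant ident_proj_spec (x : V) : ident_vertex u v -> Prop :=
  | IdentProjOld z of x = val z : ident_proj_spec x (Some z)
  | IdentProjNew of (x == u) || (x == v) : ident_proj_spec x None.

Lemma ident_projP x : ident_proj_spec x (ident_proj x).
Proof.
rewrite /ident_proj; case: insubP => [z _ <-|]; first by constructor.
by rewrite negb_and !negbK; constructor.
Qed.

Lemma ident_proj_new x : (x == u) || (x == v) -> ident_proj x = None.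
Proof. by case: ident_projP => // z ->; have /andP[/negbTE-> /negbTE->] := valP z. Qed.

Lemma ident_contraction : contraction G (ident G u v) ident_proj.
Proof.
split=> [[z|]|a a'].
- by exists (val z); apply: ident_proj_val.
- by exists u; rewrite ident_proj_new ?eqxx.
split=> [aa'|[neq [x [y [xy xa ya']]]]].
  split; first by apply: contraTneq aa' => ->; rewrite adj_irr.
  case: a a' aa' => [z|] [z'|] //= zz'.
  - by exists (val z), (val z'); rewrite !ident_proj_val.
  - by case/orP: zz' => zz'; [exists (val z), u|exists (val z), v];
      rewrite ident_proj_val ident_proj_new ?eqxx ?orbT // adj_sym.
  - by case/orP: zz' => zz'; [exists u, (val z')|exists v, (val z')];
      rewrite ident_proj_val ident_proj_new ?eqxx ?orbT.
rewrite -{}xa -{}ya' in neq *; move: xy neq.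
case: (ident_projP x) (ident_projP y) =>
    [z ->|/orP[]/eqP->] [z' ->|/orP[]/eqP->] //= xy _.
- by rewrite adj_sym xy.
- by rewrite (adj_sym G v) xy orbT.
- by rewrite xy.
- by rewrite xy orbT.
Qed.

Lemma card_ident : u != v -> #|ident_vertex u v|.+1 = #|V|.
Proof.
move=> uv; rewrite card_option card_sig.
have -> : #|[pred x | (x != u) && (x != v)]| = #|~: [set u; v]|.
  by apply: eq_card => x; rewrite !inE negb_or.
by rewrite -(cardsC [set u; v]) cards2 uv.
Qed.

Lemma ident_proj_factor (W : Type) (f : V -> W) : f u = f v ->
  exists g : ident_vertex u v -> W, g \o ident_proj =1 f.
Proof.
move=> fuv; exists (fun a => if a is Some z then f (val z) else f u) => x /=.
by case: ident_projP => [z -> //|/orP[]/eqP->].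
Qed.

End IdentProjection.

Lemma identifiable_cluster_map b k (V : finType) (G : sgraph V) :
  identifiable (target b) k G ->
  exists (W : finType) (f : V -> W) r, cluster_map b G f r /\ #|V| <= #|W| + k.
Proof.
elim: k V G => [|k IH] V G /= [tG|].
- by have [r cm] := target_cluster_map tG; exists V, id, r; rewrite addn0.
- by [].
- by have [r cm] := target_cluster_map tG; exists V, id, r; rewrite leq_addr.
move=> [u [v [uv /IH[W [f [r [cm leVW]]]]]]].
exists W, (f \o ident_proj u v), r.
rewrite -(cluster_map_contraction b f r (ident_contraction G u v)).
by rewrite -(card_ident uv) addnS ltnS.
Qed.

Lemma cluster_map_identifiable b k (V W : finType) (G : sgraph V) (f : V -> W) r :
  cluster_map b G f r -> #|V| <= #|W| + k -> identifiable (target b) k G.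
Proof.
elim: k V G f => [|k IH] V G f cm leVW.
  by left; apply: (cm_injective cm); apply: (cm_card_injective cm); rewrite -[#|W|]addn0.
have [f_inj|/injectivePn[u [v uv fuv]]] := altP (injectiveP f).
  by left; apply: cm_injective cm f_inj.
right; exists u, v; split=> //; have [g gf] := ident_proj_factor fuv.
apply: (IH _ _ g); last by rewrite -(card_ident uv) addnS ltnS in leVW.
apply/(cluster_map_contraction b g r (ident_contraction G u v)).
by apply: (cm_eq cm) => x; rewrite -gf.
Qed.

Definition has_cluster_map (b : bool) (p : nat) (V : finType) (G : sgraph V) : Prop :=
  exists (f : V -> 'I_p) (r : rel 'I_p), cluster_map b G f r.

(* Parts outside the chosen [p] ones are merged into a chosen part of their own
   component if there is one, and into a fixed chosen part otherwise. *)
Lemma cluster_map_shrink b (V W : finType) (G : sgraph V) (f : V -> W) r p :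
  cluster_map b G f r -> 0 < p <= #|W| -> has_cluster_map b p G.
Proof.
move=> cm; case: p => // p /= le_pW.
pose chosen (i : 'I_p.+1) : W := enum_val (widen_ord le_pW i).
have chosen_inj : injective chosen by move=> i j /enum_val_inj [] /val_inj.
pose rho c := if [pick i | chosen i == c] is Some i then i else
  if [pick i | r c (chosen i)] is Some i then i else ord0.
have rhoK i : rho (chosen i) = i.
  by rewrite /rho; case: pickP => [j /eqP/chosen_inj //|/(_ i)]; rewrite eqxx.
have rho_same c i : r c (chosen i) -> r c (chosen (rho c)).
  rewrite /rho; case: pickP => [j /eqP-> _|_ ci]; first exact: cm_refl cm _.
  by case: pickP => [//|/(_ i)]; rewrite ci.
have rho_default c : (forall i, ~~ r c (chosen i)) -> rho c = ord0.
  move=> none; rewrite /rho; case: pickP => [j /eqP jc|_].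
    by have := none j; rewrite jc (cm_refl cm).
  by case: pickP => [j|//]; rewrite (negbTE (none j)).
have rho_r c c' : r c c' -> r (chosen (rho c)) (chosen (rho c')).
  move=> cc'; have [i ci|none] := pickP (fun i => r c (chosen i)).
    rewrite -(cm_left_trans cm (rho_same c i ci)) (cm_left_trans cm cc').
    by apply: (rho_same c' i); rewrite -(cm_left_trans cm cc').
  rewrite !rho_default ?(cm_refl cm) // => i; last by rewrite none.
  by rewrite -(cm_left_trans cm cc') none.
exists (rho \o f), (fun i j => r (chosen i) (chosen j)); split.
- apply/equivalence_relP; split=> [i|i j ij k]; first exact: cm_refl cm _.
  by rewrite (cm_left_trans cm ij).
- by move=> conn c c'; apply: cm_total cm conn _ _.
- by move=> x y /(cm_adj cm)/rho_r.
- by move=> i; have [x fx] := cm_surj cm (chosen i); exists x; rewrite /= fx rhoK.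
- move=> i j ij /(cm_edge cm)[|x [y [xy fx fy]]]; first by rewrite inj_eq.
  by exists x, y; rewrite /= fx fy !rhoK.
Qed.

Lemma identifiable_iff_cluster_map b k (V : finType) (G : sgraph V) : k < #|V| ->
  identifiable (target b) k G <-> has_cluster_map b (#|V| - k) G.
Proof.
move=> kV; split=> [/identifiable_cluster_map[W [f [r [cm leVW]]]]|[f [r cm]]].
  by apply: cluster_map_shrink cm _; lia.
by apply: cluster_map_identifiable cm _; rewrite card_ord; lia.
Qed.

Lemma identifiable_large_budget b k (V : finType) (G : sgraph V) :
  #|V| <= k -> identifiable (target b) k G.
Proof.
move=> leVk; have [x _|V0] := pickP (@predT V); last first.
  apply: (@cluster_map_identifiable b k V V G id (fun _ _ => true)); last lia.
  by split=> // c; have := V0 c.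
apply: (@cluster_map_identifiable b k V unit G (fun=> tt) (fun _ _ => true)).
  by split=> // -[]; exists x.
by rewrite card_unit; lia.
Qed.

(** * Sparse subgraphs carrying cluster maps *)

Section Arcs.

Variable V : finType.
Implicit Types H : rel V.

Definition arcs H : nat := \sum_u #|H u|.

Lemma subrel_leq_degree H H' u : subrel H H' -> #|H u| <= #|H' u|.
Proof. by move=> HH'; apply/subset_leq_card/subsetP => v; apply: HH'. Qed.

Lemma subrel_leq_arcs H H' : subrel H H' -> arcs H <= arcs H'.
Proof. by move=> HH'; apply: leq_sum => u _; apply: subrel_leq_degree. Qed.

Lemma exists_arc_avoiding H (U : {set V}) D :
  symmetric H -> (forall u, #|H u| <= D) -> 2 * #|U| * D < arcs H ->
  exists u v, [/\ H u v, u \notin U & v \notin U].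
Proof.
move=> symH degH; have [[u v] /= /and3P[uv uU vU]|noarc] :=
    pickP (fun e : V * V => [&& H e.1 e.2, e.1 \notin U & e.2 \notin U]).
  by exists u, v.
suff arcs_le : arcs H <= 2 * #|U| * D by lia.
have le_out : \sum_u (u \in U) * #|H u| <= #|U| * D.
  rewrite -sum_nat_const [leqRHS]big_mkcond; apply: leq_sum => u _.
  by case: (u \in U); rewrite ?mul1n.
have out_in : \sum_u (u \in U) * #|H u| = \sum_u \sum_v (v \in U) * H u v.
  rewrite [RHS]exchange_big; apply: eq_bigr => v _.
  by rewrite -sum_nat_of_bool big_distrr; apply: eq_bigr => u _; rewrite symH.
rewrite -mulnA mul2n -addnn; apply: leq_trans (leq_add le_out le_out).
rewrite {2}out_in -big_split; apply: leq_sum => u _.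
rewrite -sum_nat_of_bool big_distrr -big_split; apply: leq_sum => v _ /=.
by have /= := noarc (u, v); case: (H u v) (u \in U) (v \in U) => [] [] [].
Qed.

End Arcs.

Section Greedy.

Variables (V : finType) (G : sgraph V) (D M : nat).
Implicit Type H : rel V.

Definition add_edge H (u v : V) : rel V := fun i j =>
  [|| H i j, (i == u) && (j == v) | (i == v) && (j == u)].

Definition greedy_step H (e : V * V) : rel V :=
  if [&& adj G e.1 e.2, #|H e.1| < D, #|H e.2| < D & arcs H < M]
  then add_edge H e.1 e.2 else H.

Definition greedy (s : seq (V * V)) : rel V := foldl greedy_step (fun _ _ => false) s.

Definition bounded_subgraph H : Prop :=
  [/\ symmetric H, subrel H (adj G), forall u, #|H u| <= D & arcs H <= M.+1].

Lemma sub_greedy_step H e : subrel H (greedy_step H e).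
Proof. by move=> i j ij; rewrite /greedy_step /add_edge; case: ifP; rewrite ij. Qed.

Lemma degree_add_edge H u v i : #|add_edge H u v i| <= #|H i| + (i == u) + (i == v).
Proof.
have cardT (P : pred V) b (w : V) : (forall j, P j = b && (j == w)) -> #|P| = b.
  by case: b => Pw; [apply: (eq_card1 (x := w)) => j|apply: eq_card0 => j];
    rewrite unfold_in Pw.
rewrite -addnA -(cardT (fun j => (i == u) && (j == v)) _ v) //.
rewrite -(cardT (fun j => (i == v) && (j == u)) _ u) //.
rewrite -!sum_nat_of_bool -!big_split; apply: leq_sum => j _ /=; rewrite /add_edge.
by case: (H i j) (_ && _) (_ && _) => [] [] [].
Qed.

Lemma arcs_add_edge H u v : arcs (add_edge H u v) <= (arcs H).+2.
Proof.
apply: (@leq_trans (\sum_i (#|H i| + (i == u) + (i == v)))).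
  by apply: leq_sum => i _; apply: degree_add_edge.
rewrite !big_split /= !sum_nat_of_bool.
by rewrite (eq_card1 (x := u)) // (eq_card1 (x := v)) // -addnA addn2.
Qed.

Lemma bounded_greedy_step H e : bounded_subgraph H -> bounded_subgraph (greedy_step H e).
Proof.
case: e => u v [symH HG degH arcsH]; rewrite /greedy_step /=.
case: ifP => // /and4P[uv degu degv small].
have /negbTE u_neq_v : u != v by apply: contraTneq uv => ->; rewrite adj_irr.
split=> [i j|i j|i|].
- rewrite /add_edge symH; congr (_ || _).
  by rewrite orbC [(j == u) && _]andbC [(j == v) && _]andbC.
- by case/or3P=> [/HG //||] /andP[/eqP-> /eqP->]; rewrite // adj_sym.
- apply: leq_trans (degree_add_edge _ _ _ _) _.
  have [->|_] := eqVneq i u; first by rewrite u_neq_v; lia.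
  by have [->|_] := eqVneq i v; [lia|rewrite !addn0].
- by apply: leq_trans (arcs_add_edge _ _ _) _.
Qed.

Lemma greedy_bounded s : bounded_subgraph (greedy s).
Proof.
elim/last_ind: s => [|s e IH]; last first.
  by rewrite /greedy foldl_rcons; apply: bounded_greedy_step.
have no_arc : forall u : V, #|(fun _ => false) : pred V| = 0 by move=> u; apply: eq_card0.
by split=> // [u|]; rewrite ?no_arc // /arcs (eq_bigr _ (fun u _ => no_arc u)) big1_eq.
Qed.

Lemma greedy_saturated s u v : (u, v) \in s -> adj G u v ->
  [|| greedy s u v, D <= #|greedy s u|, D <= #|greedy s v| | M <= arcs (greedy s)].
Proof.
elim/last_ind: s => // s e IH; rewrite mem_rcons inE {1 2 3 4}/greedy foldl_rcons.
rewrite -/(greedy s); have [<- _ uv|_ /= uvs uv] := eqVneq (u, v) e.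
  rewrite /greedy_step /= uv /=; case: ifP => [_|]; first by rewrite /add_edge !eqxx orbT.
  by move=> /negbT; rewrite !negb_and -!leqNgt => ->; rewrite orbT.
have sub := @sub_greedy_step (greedy s) e.
case/or4P: (IH uvs uv) => [/sub->//|le_D|le_D|le_M]; apply/or4P.
- by apply: Or42; apply: leq_trans (subrel_leq_degree u sub).
- by apply: Or43; apply: leq_trans (subrel_leq_degree v sub).
- by apply: Or44; apply: leq_trans (subrel_leq_arcs sub).
Qed.

End Greedy.

Section Recolouring.

Variables (V W : finType) (G : sgraph V) (H : rel V) (D : nat).
Hypotheses (symH : symmetric H) (HG : subrel H (adj G)).
Implicit Types (U : {set V}) (f g : V -> W).

Definition recolouring U f g : Prop :=
  {in U, g =1 f} /\ forall x, exists2 y, connect (adj G) x y & g x = f y.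

Definition joined g (c c' : W) : Prop := exists u v, [/\ H u v, g u = c & g v = c'].

Lemma joined_sym g c c' : joined g c c' -> joined g c' c.
Proof. by move=> [u [v [uv gu gv]]]; exists v, u; rewrite symH. Qed.

Lemma recolouring_trans U U' f g h :
  U \subset U' -> recolouring U f g -> recolouring U' g h -> recolouring U f h.
Proof.
move=> /subsetP sUU' [fg cfg] [gh cgh]; split=> [x xU|x].
  by rewrite gh ?fg // sUU'.
have [y xy ->] := cgh x; have [z yz ->] := cfg y.
by exists z; first exact: connect_trans yz.
Qed.

Definition saturated : Prop :=
  forall u v, adj G u v -> [|| H u v, D <= #|H u| | D <= #|H v|].

Definition joinable U f (c c' : W) : Prop := exists U' g,
  [/\ #|U'| <= #|U|.+1, recolouring U f g, U \subset U'
    & forall h, {in U', h =1 g} -> joined h c c'].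

(* The vertex [a] of large degree has a neighbour outside [U], which takes over the
   colour of [b]. *)
Lemma join_fresh_nbr U f a b :
  a \in U -> adj G a b -> #|U| < #|H a| -> joinable U f (f a) (f b).
Proof.
move=> aU ab degU; have /subsetPn[w aw wU] : ~~ ([pred w | H a w] \subset U).
  by apply: contraL degU => /subset_leq_card; rewrite -leqNgt.
pose g x := if x == w then f b else f x.
have gU : {in U, g =1 f} by rewrite /g => x xU; case: eqP xU wU => // -> ->.
exists (w |: U), g; split; last 2 first; [exact: subsetUr | | |].
- move=> h hg; exists a, w; rewrite !hg ?setU11 ?setU1r //.
  by rewrite gU // /g eqxx.
- by rewrite cardsU1 -add1n leq_add2r leq_b1.
- split=> // x; rewrite /g; case: eqP => [->|_]; last by exists x.
  exists b => //; apply: (connect_trans (y := a)); apply: connect1 => //.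
  by rewrite adj_sym HG.
Qed.

Lemma join_edge U f a b :
  saturated -> a \in U -> b \in U -> adj G a b -> #|U| < D -> joinable U f (f a) (f b).
Proof.
move=> sat aU bU ab UD; have /or3P[Hab|dega|degb] := sat a b ab.
- by exists U, f; split=> // [|h hf]; [split=> // x; exists x|exists a, b; rewrite !hf].
- exact: join_fresh_nbr aU ab (leq_trans UD dega).
- rewrite adj_sym in ab.
  have [U' [g [leU fg sUU' join]]] := join_fresh_nbr f bU ab (leq_trans UD degb).
  by exists U', g; split=> // h /join/joined_sym.
Qed.

Lemma join_edges (s : seq (V * V)) U f :
  saturated -> (forall e, e \in s -> [/\ e.1 \in U, e.2 \in U & adj G e.1 e.2]) ->
  #|U| + size s <= D -> exists g,
    recolouring U f g /\ forall e, e \in s -> joined g (f e.1) (f e.2).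
Proof.
move=> sat; elim: s U f => [|[a b] s IH] U f sU leD.
  by exists f; split=> //; split=> // x; exists x.
have [/= aU bU ab] := sU _ (mem_head _ _); rewrite /= in leD.
have UD : #|U| < D by lia.
have [U' [f' [leU ff' sUU' join]]] := join_edge f sat aU bU ab UD.
have sU' e : e \in s -> [/\ e.1 \in U', e.2 \in U' & adj G e.1 e.2].
  by move=> es; have [|? ? ?] := sU e; [rewrite inE es orbT|rewrite !(subsetP sUU')].
have [|g [f'g joins]] := IH U' f' sU'; first by lia.
exists g; split=> [|e]; first exact: recolouring_trans sUU' ff' f'g.
rewrite inE => /predU1P[->|es]; first by apply: join; case: f'g.
have [? ? _] := sU e (mem_behead (s := (a, b) :: s) es).
by have [f'f _] := ff'; rewrite -!f'f //; apply: joins.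
Qed.

Lemma join_all_pairs (s : seq (W * W)) U f :
  (forall u, #|H u| <= D) -> 0 < D -> 2 * (#|U| + 2 * size s) * D <= arcs H ->
  exists g, {in U, g =1 f} /\ forall c, c \in s -> joined g c.1 c.2.
Proof.
move=> degH D0; elim: s U f => [|[c c'] s IH] U f le_arcs; first by exists f.
have [|u [v [uv uU vU]]] := @exists_arc_avoiding V H U D symH degH.
  by apply: leq_trans le_arcs => /=; nia.
have v_neq_u : v != u by apply: contraTneq uv => ->; apply: contraFN (adj_irr G u) => /HG.
pose f' x := if x == u then c else if x == v then c' else f x.
have [|g [gU joins]] := IH (u |: (v |: U)) f'.
  apply: leq_trans le_arcs; rewrite !cardsU1 !inE eq_sym (negbTE v_neq_u) uU vU /=; nia.
exists g; split=> [x xU|e].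
  rewrite gU ?inE ?xU ?orbT // /f'.
  by case: eqP xU uU => [-> ->//|_ xU _]; case: eqP xU vU => // -> ->.
rewrite inE => /predU1P[->|/joins //].
by exists u, v; rewrite !gU ?inE ?eqxx ?orbT // /f' eqxx (negbTE v_neq_u) eqxx.
Qed.

End Recolouring.

Lemma cm_edge_seq b (V W : finType) (G : sgraph V) (f : V -> W) r :
  cluster_map b G f r -> exists s : seq (V * V),
    [/\ size s <= #|W| ^ 2, forall e, e \in s -> adj G e.1 e.2
      & forall c c', c != c' -> r c c' -> exists2 e, e \in s & f e.1 = c /\ f e.2 = c'].
Proof.
move=> cm.
pose joins (c : W * W) (e : V * V) := [&& adj G e.1 e.2, f e.1 == c.1 & f e.2 == c.2].
exists (pmap (fun c => [pick e | joins c e]) (enum {: W * W})); split.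
- by rewrite size_pmap (leq_trans (count_size _ _)) // -cardE card_prod mulnn.
- by move=> e; rewrite mem_pmap => /mapP[c _]; case: pickP => // e' /and3P[? _ _] [->].
move=> c c' cc' /(cm_edge cm cc')[x [y [xy fx fy]]].
case joinsE: [pick e | joins (c, c') e] => [e|]; last first.
  by move: joinsE; case: pickP => // /(_ (x, y)); rewrite /joins /= xy fx fy !eqxx.
exists e.
  by rewrite mem_pmap -joinsE; apply/mapP; exists (c, c'); rewrite ?mem_enum.
by move: joinsE; case: pickP => // e' /and3P[_ /eqP fe1 /eqP fe2] [<-].
Qed.

(* The maps [g \o m] are those that factor through the contraction that merges [x] into
   [m x]. *)
Section Merging.

Variables (V W : finType) (G : sgraph V) (H : rel V) (D : nat) (m : V -> V).
Hypotheses (symH : symmetric H) (HG : subrel H (adj G)).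
Hypothesis m_fix : forall u v, H u v -> m u = u.

Lemma joined_merge (g : V -> W) c c' :
  joined H g c c' -> exists x y, [/\ adj G x y, g (m x) = c & g (m y) = c'].
Proof.
move=> [u [v [uv <- <-]]]; exists u, v.
by rewrite (m_fix uv) (@m_fix v u) 1?symH //; split=> //; apply: HG.
Qed.

Lemma cluster_map_merge (b : bool) (f : V -> W) r :
  saturated G H D -> 3 * #|W| ^ 2 <= D -> b \/ (forall x, connect (adj G) x (m x)) ->
  cluster_map b G f r -> exists g, cluster_map b G (g \o m) r.
Proof.
move=> sat leD conn cm; have [s [size_s sG s_edge]] := cm_edge_seq cm.
pose U := [set x in map fst s ++ map snd s].
have leU : #|U| <= 2 * size s.
  by rewrite cardsE (leq_trans (card_size _)) // size_cat !size_map mul2n addnn.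
have [e es||g [[_ g_conn] joins]] := join_edges (s := s) (U := U) symH HG f sat.
- by split; [rewrite inE mem_cat map_f|rewrite inE mem_cat map_f ?orbT|apply: sG].
- by lia.
have r_merge x : r (f x) (g (m x)).
  case: conn => [conn|conn]; first exact: cm_total cm conn _ _.
  have [y xy ->] := g_conn (m x); apply: (cm_connect cm).
  exact: connect_trans (conn x) xy.
have g_edge c c' : c != c' -> r c c' ->
    exists x y, [/\ adj G x y, g (m x) = c & g (m y) = c'].
  by move=> cc' /(s_edge c c' cc')[e es [<- <-]]; apply/joined_merge/joins.
exists g; split=> // [||x y xy|c].
- exact: cm_equiv cm.
- exact: cm_total cm.
- apply: (cm_trans cm) _ (r_merge y); rewrite (cm_sym cm).
  by apply: (cm_trans cm) _ (r_merge x); rewrite (cm_sym cm); apply: (cm_adj cm).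
have [c' /andP[cc' rcc']|alone] := pickP (fun c' => (c != c') && r c c').
  by have [x [_ [_ <- _]]] := g_edge c c' cc' rcc'; exists x.
have [x fx] := cm_surj cm c; exists x => /=; apply/esym/eqP.
by have := alone (g (m x)); rewrite -{2}fx r_merge andbT => /negbFE.
Qed.

Lemma cluster_map_merge_many_arcs b (c0 : W) :
  (forall u, #|H u| <= D) -> 0 < D -> 4 * #|W| ^ 2 * D <= arcs H ->
  exists g r, cluster_map b G (g \o m : V -> W) r.
Proof.
move=> degH D0 le_arcs.
have [|g [_ joins]] :=
    join_all_pairs symH HG (s := enum {: W * W}) (U := set0) (fun=> c0) degH D0.
  by rewrite cards0 add0n -cardE card_prod mulnn mulnA.
have g_edge c c' : exists x y, [/\ adj G x y, g (m x) = c & g (m y) = c'].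
  by apply/joined_merge/(joins (c, c')); rewrite mem_enum.
exists g, (fun _ _ => true); split=> // c.
by have [x [_ [_ <- _]]] := g_edge c c; exists x.
Qed.

End Merging.

Lemma cluster_map_merge_isolated (V W : finType) (G : sgraph V) (m : V -> V)
    (j : W -> V) (c0 : W) :
  injective j -> (forall c, m (j c) = j c) -> (forall c x y, adj G x y -> m x != j c) ->
  exists g r, cluster_map false G (g \o m : V -> W) r.
Proof.
move=> j_inj jK iso; pose g a := odflt c0 [pick c | j c == a].
have gj c : g (j c) = c.
  by rewrite /g; case: pickP => [c' /eqP/j_inj //|/(_ c)]; rewrite eqxx.
have g_default x y : adj G x y -> g (m x) = c0.
  by move=> xy; rewrite /g; case: pickP => // c; rewrite eq_sym (negbTE (iso c x y xy)).
exists g, eq_op; split=> //.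
- by apply/equivalence_relP; split=> [c|c c' /eqP->]; rewrite ?eqxx.
- by move=> x y xy /=; rewrite (g_default x y) // (g_default y x) // adj_sym.
- by move=> c; exists (j c); rewrite /= jK gj.
- by move=> c c' /negbTE->.
Qed.

(** * The kernel *)

Section Rank.

Variables (n : nat) (A : {set 'I_n}).

Definition rank (x : 'I_n) : nat := #|[set y in A | y < x]|.

Lemma rank_leq_order x : rank x <= n.
Proof. by rewrite -[leqRHS]card_ord max_card. Qed.

Lemma sorted_enum_set : sorted <%O (enum A).
Proof.
rewrite /enum_mem -enumT; apply: lt_sorted_filter.
by have := iota_ltn_sorted 0 n; rewrite ltEord -val_enum_ord sorted_map.
Qed.

Lemma rank_enum_val (i : 'I_#|A|) : rank (enum_val i) = i.
Proof.
have lt_i : i < size (enum A) by rewrite -cardE.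
rewrite -[RHS](count_lt_nth (enum_val i) sorted_enum_set lt_i) -enum_val_nth.
by rewrite -sum1_count big_enum_cond sum1dep_card.
Qed.

Lemma enum_valW x : x \in A -> exists i : 'I_#|A|, x = enum_val i.
Proof. by move=> xA; exists (enum_rank_in xA x); rewrite enum_rankK_in. Qed.

Lemma rank_lt_card x : x \in A -> rank x < #|A|.
Proof. by move=> /enum_valW[i ->]; rewrite rank_enum_val. Qed.

Lemma rank_inj : {in A &, injective rank}.
Proof.
move=> x y /enum_valW[i ->] /enum_valW[j ->]; rewrite !rank_enum_val.
by move=> /val_inj ->.
Qed.

Lemma head_enum_in x0 x : x \in A -> head x0 (enum A) \in A.
Proof.
rewrite -mem_enum; case enumA: (enum A) => [//|y s] _ /=.
by rewrite -mem_enum enumA mem_head.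
Qed.

Lemma eq_head_enum x0 x : x \in A -> (head x0 (enum A) == x) = (rank x == 0).
Proof.
move=> /enum_valW[i ->]; rewrite rank_enum_val (enum_val_nth x0) -nth0.
by rewrite nth_uniq -?cardE ?enum_uniq // ?(leq_ltn_trans _ (ltn_ord i)) // eq_sym.
Qed.

End Rank.

Lemma eq_rank_pair n (A : {set 'I_n}) u v (i j : 'I_#|A|) : u \in A -> v \in A ->
  (rank A u * #|A| + rank A v == i * #|A| + j) = (u == enum_val i) && (v == enum_val j).
Proof.
move=> /enum_valW[k ->] /enum_valW[l ->]; rewrite !rank_enum_val eqn_mulD_small //.
by rewrite !(inj_eq enum_val_inj).
Qed.

Definition isolated (V : finType) (G : sgraph V) : {set V} := [set x | #|adj G x| == 0].

Lemma adj_not_isolated (V : finType) (G : sgraph V) x y :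
  adj G x y -> x \notin isolated G.
Proof. by rewrite inE -lt0n => xy; apply/card_gt0P; exists y. Qed.

Section Kernel.

Variables (n p : nat) (G : sgraph 'I_n).

Definition deg_cap : nat := 4 * p ^ 2.
Definition arc_cap : nat := 16 * p ^ 4.

Definition sparse : rel 'I_n :=
  greedy G deg_cap arc_cap [seq (u, v) | u <- enum 'I_n, v <- enum 'I_n].

(* The vertices below [p] are kept so that the kernel can afford the budget
   [#|kept| - p]. *)
Definition kept : {set 'I_n} :=
  [set x | [|| 0 < #|sparse x|, x < p
             | (x \in isolated G) && (rank (isolated G) x < p)]].

Definition kept_nbrs (x : 'I_n) : {set 'I_n} := [set z in kept | adj G x z].

(* The default of [head], vertex [0], only concerns superfluous isolated vertices
   and graphs in which [sparse] reached [arc_cap]. *)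
Definition rep (x : 'I_n) : 'I_n :=
  if x \in kept then x
  else head (Ordinal (leq_ltn_trans (leq0n x) (ltn_ord x))) (enum (kept_nbrs x)).

Definition merged_adj : rel 'I_n := fun u v =>
  (u != v) && [exists x, exists y, [&& rep x == u, rep y == v & adj G x y]].

Definition kernel_rel : rel 'I_#|kept| :=
  fun a b => merged_adj (enum_val a) (enum_val b).

Lemma kernel_sym : symmetric kernel_rel.
Proof.
move=> a b; rewrite /kernel_rel /merged_adj eq_sym; congr (_ && _).
by apply/existsP/existsP => -[x /existsP[y /and3P[xa yb xy]]]; exists y;
  apply/existsP; exists x; rewrite xa yb adj_sym.
Qed.

Lemma kernel_irr : irreflexive kernel_rel.
Proof. by move=> a; rewrite /kernel_rel /merged_adj eqxx. Qed.

Definition kernel : sgraph 'I_#|kept| := SGraph kernel_sym kernel_irr.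

Lemma sparse_bounded : bounded_subgraph G deg_cap arc_cap sparse.
Proof. exact: greedy_bounded. Qed.

Lemma sparse_saturated : arcs sparse < arc_cap -> saturated G sparse deg_cap.
Proof.
move=> small u v uv.
have all_pairs : (u, v) \in [seq (u, v) | u <- enum 'I_n, v <- enum 'I_n].
  by rewrite allpairs_f ?mem_enum.
have := greedy_saturated deg_cap arc_cap all_pairs uv.
by rewrite -/sparse [arc_cap <= _]leqNgt small orbF.
Qed.

Lemma card_kept_le : #|kept| <= arc_cap.+1 + 2 * p.
Proof.
have [_ _ _ arcs_le] := sparse_bounded.
pose small : {set _} := [set x : 'I_n | x < p].
pose first_isolated := [set x in isolated G | rank (isolated G) x < p].
have le_small : #|small| <= p.
  by apply: (card_leq_inj (h := val)) => [x y _ _ /val_inj //|x]; rewrite inE.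
have le_isolated : #|first_isolated| <= p.
  apply: (card_leq_inj (h := rank (isolated G))) => [x y|x]; rewrite inE => /andP[//].
  by move=> ix _; rewrite inE => /andP[iy _]; apply: rank_inj.
have le_sparse : #|[set x | 0 < #|sparse x|]| <= arcs sparse.
  rewrite -sum1dep_card big_mkcond; apply: leq_sum => x _.
  by case: #|sparse x|.
have -> : kept = [set x | 0 < #|sparse x|] :|: (small :|: first_isolated).
  by apply/setP => x; rewrite !inE.
apply: leq_trans (leq_card_setU _ _) _.
rewrite mul2n -addnn leq_add ?(leq_trans le_sparse) //.
exact: leq_trans (leq_card_setU _ _) (leq_add le_small le_isolated).
Qed.

Lemma card_kept_ge : p <= n -> p <= #|kept|.
Proof.
move=> pn; have widen_inj : injective (widen_ord pn) by move=> i j [] /val_inj.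
rewrite -{1}[p]card_ord -(card_imset _ widen_inj).
apply/subset_leq_card/subsetP => _ /imsetP[i _ ->].
by rewrite inE /= ltn_ord orbT.
Qed.

Lemma card_kept_leq_order : #|kept| <= n.
Proof. by rewrite -[leqRHS]card_ord max_card. Qed.

Lemma rep_id x : x \in kept -> rep x = x.
Proof. by rewrite /rep => ->. Qed.

Lemma rep_in_kept x : 0 < p -> rep x \in kept.
Proof.
move=> p_gt0; rewrite /rep; case: ifP => // _.
have [->|[z zx]] := set_0Vmem (kept_nbrs x); first by rewrite enum_set0 inE /= p_gt0 orbT.
set x0 := Ordinal _; have := head_enum_in x0 zx.
by rewrite inE => /andP[].
Qed.

Lemma rep_adj_of_nbr x z : x \notin kept -> z \in kept_nbrs x -> adj G x (rep x).
Proof.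
move=> /negbTE notkept zx; rewrite /rep notkept.
set x0 := Ordinal _; have := head_enum_in x0 zx.
by rewrite inE => /andP[].
Qed.

Lemma eq_rep x y : (rep x == y) =
  if x \in kept then y == x else
  if #|kept_nbrs x| != 0 then (y \in kept_nbrs x) && (rank (kept_nbrs x) y == 0)
  else y == 0 :> nat.
Proof.
rewrite /rep; case: ifP => _; first by rewrite eq_sym.
case: ifPn => [|/negbNE]; rewrite cards_eq0; last first.
  by move=> /eqP->; rewrite enum_set0 eq_sym.
case/set0Pn=> z zx; have [yx|yx] := boolP (y \in kept_nbrs x); first exact: eq_head_enum.
by apply: contraNF yx => /eqP <-; apply: head_enum_in zx.
Qed.

Lemma kernel_contraction : 0 < p ->
  exists2 phi, contraction G kernel phi & forall x, enum_val (phi x) = rep x.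
Proof.
move=> p_gt0.
have /fin_all_exists[phi phiE] x : exists a : 'I_#|kept|, enum_val a = rep x.
  by have [a ->] := enum_valW (rep_in_kept x p_gt0); exists a.
exists phi => //; split=> [a|a a'].
  by exists (enum_val a); apply: enum_val_inj; rewrite phiE rep_id ?enum_valP.
rewrite /= /kernel_rel /merged_adj (inj_eq enum_val_inj).
split=> [/andP[aa' /existsP[x /existsP[y]]]|[-> [x [y [xy <- <-]]]]].
  rewrite -!phiE !(inj_eq enum_val_inj) => /and3P[/eqP xa /eqP ya' xy].
  by split=> //; exists x, y.
by apply/existsP; exists x; apply/existsP; exists y; rewrite !phiE !eqxx.
Qed.

Lemma kernel_has_cluster_map b (g : 'I_n -> 'I_p) r :
  0 < p -> cluster_map b G (g \o rep) r -> has_cluster_map b p kernel.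
Proof.
move=> /kernel_contraction[phi contr phiE] cm; exists (g \o enum_val), r.
by apply/(cluster_map_contraction b _ _ contr)/(cm_eq cm) => x; rewrite /= phiE.
Qed.

Lemma rep_sparse u v : sparse u v -> rep u = u.
Proof.
move=> uv; apply: rep_id; rewrite inE; apply/orP; left.
by apply/card_gt0P; exists v.
Qed.

Lemma rep_adj x y : 0 < p -> arcs sparse < arc_cap -> adj G x y ->
  rep x = x \/ adj G x (rep x).
Proof.
move=> p_gt0 small xy; have [/rep_id ->|xk] := boolP (x \in kept); [by left|right].
apply: (rep_adj_of_nbr (z := y)) => //; rewrite !inE xy andbT; apply/orP; left.
have cap_gt0 : 0 < deg_cap by rewrite muln_gt0 expn_gt0 p_gt0.
have degx : #|sparse x| = 0.
  by apply/eqP; move: xk; rewrite inE negb_or -leqNgt leqn0 => /andP[].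
have /or3P[xy_sparse||/(leq_trans cap_gt0) //] := sparse_saturated small xy.
  have [symH _ _ _] := sparse_bounded; rewrite symH in xy_sparse.
  by apply/card_gt0P; exists x.
by rewrite degx leqNgt cap_gt0.
Qed.

Lemma kernel_many_isolated x :
  arcs sparse < arc_cap -> x \in isolated G -> x \notin kept ->
  0 < p -> has_cluster_map false p kernel.
Proof.
move=> small xi xk p_gt0; have p_le : p <= #|isolated G|.
  apply: leq_trans (ltnW (rank_lt_card xi)); rewrite leqNgt.
  by apply: contra xk => rank_lt; rewrite inE xi rank_lt !orbT.
pose j (i : 'I_p) := enum_val (widen_ord p_le i).
have j_isolated i : j i \in isolated G by apply: enum_valP.
have [|i|i y z yz|g [r cm]] :=
    @cluster_map_merge_isolated _ _ G rep j (Ordinal p_gt0).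
- by move=> i i' /enum_val_inj [] /val_inj.
- by apply: rep_id; rewrite inE j_isolated rank_enum_val /= ltn_ord !orbT.
- apply: contraTneq (j_isolated i) => <-.
  have [->|yz'] := rep_adj p_gt0 small yz; first exact: adj_not_isolated yz.
  by rewrite adj_sym in yz'; apply: adj_not_isolated yz'.
exact: kernel_has_cluster_map cm.
Qed.

Lemma kernel_many_arcs b : 0 < p -> arc_cap <= arcs sparse -> has_cluster_map b p kernel.
Proof.
move=> p_gt0 many; have [symH HG degH _] := sparse_bounded.
have [||g [r cm]] :=
    cluster_map_merge_many_arcs symH HG rep_sparse b (Ordinal p_gt0) degH.
- by rewrite muln_gt0 expn_gt0 p_gt0.
- by rewrite card_ord mulnACA -expnD.
exact: kernel_has_cluster_map cm.
Qed.

Lemma has_cluster_map_kernel b : 0 < p ->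
  has_cluster_map b p G <-> has_cluster_map b p kernel.
Proof.
move=> p_gt0; split=> [[f [r cm]]|[f [r cm]]]; last first.
  have [phi contr _] := kernel_contraction p_gt0.
  by exists (f \o phi), r; apply/(cluster_map_contraction b f r contr).
have [many|small] := leqP arc_cap (arcs sparse); first exact: kernel_many_arcs.
have [symH HG _ _] := sparse_bounded.
have [/orP conn|] := boolP (b || [forall x, (x \in isolated G) ==> (x \in kept)]).
  have [||g cm'] :=
      cluster_map_merge symH HG rep_sparse (sparse_saturated small) _ _ cm.
  - by rewrite card_ord leq_mul2r orbT.
  - case: conn => [|/forallP all_kept]; [by left|right=> x].
    have [/rep_id->|xk] := boolP (x \in kept); first exact: connect0.
    have : x \notin isolated G by apply: contra xk; apply/implyP.
    rewrite inE -lt0n => /card_gt0P[y xy].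
    by have [->|xm] := rep_adj p_gt0 small xy; [apply: connect0|apply: connect1].
  exact: kernel_has_cluster_map cm'.
rewrite negb_or => /andP[/negbTE-> /forallPn[x]]; rewrite negb_imply => /andP[xi xk].
exact: kernel_many_isolated xi xk p_gt0.
Qed.

End Kernel.

(** * Total correctness of machine programs within a time bound *)

Definition runs (c : ram) (st : ram_state) (B : nat) (Q : ram_state -> Prop) : Prop :=
  exists t st', [/\ ram_exec c st t st', t <= B & Q st'].

Section Runs.

Implicit Types (st : ram_state) (Q : ram_state -> Prop).

Lemma runs_weaken c st B Q Q' :
  runs c st B Q -> (forall st', Q st' -> Q' st') -> runs c st B Q'.
Proof. by move=> [t [st' [ex tB Qst']]] QQ'; exists t, st'; split=> //; apply: QQ'. Qed.

Lemma runs_const i a st Q : Q (set_reg st i a) -> runs (Const i a) st 1 Q.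
Proof. by move=> Qst; eexists 1, _; split; [constructor| |]. Qed.

Lemma runs_add i j k st Q :
  Q (set_reg st i (reg st j + reg st k)) -> runs (Add i j k) st 1 Q.
Proof. by move=> Qst; eexists 1, _; split; [constructor| |]. Qed.

Lemma runs_sub i j k st Q :
  Q (set_reg st i (reg st j - reg st k)) -> runs (Sub i j k) st 1 Q.
Proof. by move=> Qst; eexists 1, _; split; [constructor| |]. Qed.

Lemma runs_read i j st Q :
  Q (set_reg st i (mem st (reg st j))) -> runs (Read i j) st 1 Q.
Proof. by move=> Qst; eexists 1, _; split; [constructor| |]. Qed.

Lemma runs_write i j st Q :
  Q (set_mem st (reg st i) (reg st j)) -> runs (Write i j) st 1 Q.
Proof. by move=> Qst; eexists 1, _; split; [constructor| |]. Qed.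

Lemma runs_skip st Q : Q st -> runs Skip st 1 Q.
Proof. by move=> Qst; exists 1, st; split=> //; constructor. Qed.

Lemma runs_seq c1 c2 st B1 B2 Q :
  runs c1 st B1 (fun st' => runs c2 st' B2 Q) -> runs (Seq c1 c2) st (B1 + B2) Q.
Proof.
move=> [t1 [st1 [ex1 le1 [t2 [st2 [ex2 le2 Qst2]]]]]].
by exists (t1 + t2), st2; split=> //; [apply: ExecSeq ex1 ex2 | apply: leq_add].
Qed.

Lemma runs_if i c1 c2 st B1 B2 Q :
  (reg st i != 0 -> runs c1 st B1 Q) -> (reg st i = 0 -> runs c2 st B2 Q) ->
  runs (If i c1 c2) st (B1 + B2).+1 Q.
Proof.
move=> run1 run2; have [ri|ri] := eqVneq (reg st i) 0.
  have [t [st' [ex tB Qst']]] := run2 ri; exists t.+1, st'; split=> //; last by lia.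
  exact: ExecIfFalse.
have [t [st' [ex tB Qst']]] := run1 ri; exists t.+1, st'; split=> //; last by lia.
exact: ExecIfTrue.
Qed.

Lemma runs_while i c B (I : nat -> ram_state -> Prop) m st :
  (forall a st, I a st -> reg st i = a) ->
  (forall a st, I a.+1 st -> runs c st B (I a)) ->
  I m st -> runs (While i c) st (m * B.+1).+1 (I 0).
Proof.
move=> Ireg body; elim: m st => [|m IH] st Ist.
  by exists 1, st; split=> //; constructor; apply: Ireg Ist.
have [t1 [st1 [ex1 le1 I1]]] := body _ _ Ist.
have [t2 [st2 [ex2 le2 I2]]] := IH _ I1.
exists (t1 + t2).+1, st2; split=> //; last by lia.
by apply: ExecWhileStep ex1 ex2; rewrite (Ireg _ _ Ist).
Qed.

Definition copy_reg (i j : nat) : ram := Seq (Const i 0) (Add i i j).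

Lemma upd_same f i a : upd f i a i = a.
Proof. by rewrite /upd eqxx. Qed.

Lemma upd_other f i a j : j <> i -> upd f i a j = f j.
Proof. by rewrite /upd => /eqP/negbTE->. Qed.

Lemma runs_copy_reg i j st Q :
  i <> j -> Q (set_reg (set_reg st i 0) i (reg st j)) -> runs (copy_reg i j) st 2 Q.
Proof.
move=> ij Qst; apply: (@runs_seq _ _ _ 1 1); apply/runs_const/runs_add => /=.
by rewrite upd_same upd_other // => /esym.
Qed.

Fixpoint add_times (k i j : nat) : ram :=
  if k is k'.+1 then Seq (Add i i j) (add_times k' i j) else Skip.

Lemma runs_add_times k i j st :
  i <> j -> runs (add_times k i j) st k.+1 (fun st' =>
    [/\ reg st' i = reg st i + k * reg st j, mem st' = mem st
      & forall q, q <> i -> reg st' q = reg st q]).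
Proof.
move=> ij; elim: k st => [|k IH] st /=; first by apply: runs_skip; rewrite addn0.
rewrite -[k.+2]add1n; apply/runs_seq/runs_add.
apply: runs_weaken (IH _) _ => st' /=; rewrite upd_same upd_other => [|/esym //].
move=> [-> -> other]; split=> //; first by rewrite mulSn addnA.
by move=> q qi; rewrite other // upd_other.
Qed.

End Runs.

(** * A language of table programs *)

(* All variables range over the vertices [0, ..., n - 1]. *)
Inductive expr :=
  | Lit of nat
  | VertexCount
  | Budget
  | Var of nat
  | Plus of expr & expr
  | Minus of expr & expr
  | Get of nat & nat & nat       (* table, row variable, column variable *)
  | Cond of expr & expr & expr
  | Sum of nat & expr.           (* over all values of the variable *)

Inductive cmd :=
  | Tabulate of nat & nat & nat & expr  (* table, row variable, column variable *)
  | Then of cmd & cmd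
  | For of nat & cmd.

Definition tables : Type := nat -> nat -> nat -> nat.

Section Semantics.

Variables (n K : nat).

Fixpoint eval (T : tables) (env : nat -> nat) (e : expr) : nat :=
  match e with
  | Lit a => a
  | VertexCount => n
  | Budget => K
  | Var x => env x
  | Plus a b => eval T env a + eval T env b
  | Minus a b => eval T env a - eval T env b
  | Get k x y => T k (env x) (env y)
  | Cond a b c => if eval T env a != 0 then eval T env b else eval T env c
  | Sum x a => \sum_(i < n) eval T (upd env x i) a
  end.

Fixpoint exec (env : nat -> nat) (c : cmd) (T : tables) : tables :=
  match c with
  | Tabulate k x y e => fun k' i j =>
      if k' == k then eval T (upd (upd env x i) y j) e else T k' i j
  | Then c1 c2 => exec env c2 (exec env c1 T)
  | For x c => iteri n (fun i => exec (upd env x i) c) T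
  end.

End Semantics.

Fixpoint reads (k : nat) (e : expr) : bool :=
  match e with
  | Lit _ | VertexCount | Budget | Var _ => false
  | Plus a b | Minus a b => reads k a || reads k b
  | Get k' _ _ => k' == k
  | Cond a b c => [|| reads k a, reads k b | reads k c]
  | Sum _ a => reads k a
  end.

(* Free variables are in scope, and binders do not shadow variables in scope: a
   variable has a fixed register. *)
Fixpoint wf_expr (s : seq nat) (e : expr) : bool :=
  match e with
  | Lit _ | VertexCount | Budget => true
  | Var x => x \in s
  | Plus a b | Minus a b => wf_expr s a && wf_expr s b
  | Get _ x y => (x \in s) && (y \in s)
  | Cond a b c => [&& wf_expr s a, wf_expr s b & wf_expr s c]
  | Sum x a => (x \notin s) && wf_expr (x :: s) a
  end.

(* A table is overwritten cell by cell, hence may not be read meanwhile. *)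
Fixpoint wf_cmd (s : seq nat) (c : cmd) : bool :=
  match c with
  | Tabulate k x y e =>
      [&& x \notin s, y \notin x :: s, wf_expr [:: y, x & s] e & ~~ reads k e]
  | Then c1 c2 => wf_cmd s c1 && wf_cmd s c2
  | For x c => (x \notin s) && wf_cmd (x :: s) c
  end.

Lemma eval_eq_tables n K e T T' env :
  (forall k i j, reads k e -> T k i j = T' k i j) ->
  eval n K T env e = eval n K T' env e.
Proof.
elim: e env =>
    [a|||x|a IHa b IHb|a IHa b IHb|k x y|a IHa b IHb c IHc|x a IHa] env //= TT'.
- by rewrite IHa ?IHb // => k i j rd; apply: TT'; rewrite rd ?orbT.
- by rewrite IHa ?IHb // => k i j rd; apply: TT'; rewrite rd ?orbT.
- exact: TT'.
- by rewrite IHa ?IHb ?IHc // => k i j rd; apply: TT'; rewrite rd ?orbT.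
- by apply: eq_bigr => i _; apply: IHa.
Qed.

(** * Compilation of table programs *)

(* Odd registers hold the variables and their products with [n], the offsets of table
   rows; even registers hold [n], [n ^ 2], the budget, and a stack of temporaries. *)
Definition order_reg : nat := 2.
Definition area_reg : nat := 4.
Definition budget_reg : nat := 6.
Definition var_reg (x : nat) : nat := 4 * x + 1.
Definition row_reg (x : nat) : nat := 4 * x + 3.
Definition tmp (r : nat) : nat := 2 * r + 8.

(* The registers in use where the variables of [s] are in scope and the first [r]
   temporaries are occupied. *)
Definition live (s : seq nat) (r q : nat) : bool :=
  if odd q then q %/ 4 \in s else q < tmp r.

Definition keep (s : seq nat) (r : nat) (st st' : ram_state) : Prop :=
  forall q, live s r q -> reg st' q = reg st q.

Section Live.

Variables (s : seq nat) (r : nat).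

Lemma live_var x : live s r (var_reg x) = (x \in s).
Proof.
have [oddx divx] : odd (var_reg x) /\ var_reg x %/ 4 = x by rewrite /var_reg; lia.
by rewrite /live oddx divx.
Qed.

Lemma live_row x : live s r (row_reg x) = (x \in s).
Proof.
have [oddx divx] : odd (row_reg x) /\ row_reg x %/ 4 = x by rewrite /row_reg; lia.
by rewrite /live oddx divx.
Qed.

Lemma live_tmp q : live s r (tmp q) = (q < r).
Proof. by rewrite /live /tmp; have -> : odd (2 * q + 8) = false; lia. Qed.

Lemma live_order : live s r order_reg.
Proof. by rewrite /live /tmp /order_reg /=; lia. Qed.

Lemma live_area : live s r area_reg.
Proof. by rewrite /live /tmp /area_reg /=; lia. Qed.

Lemma live_budget : live s r budget_reg.
Proof. by rewrite /live /tmp /budget_reg /=; lia. Qed.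

Definition liveE := (live_var, live_row, live_tmp, live_order, live_area, live_budget).

Lemma keep_trans st2 st1 st3 : keep s r st1 st2 -> keep s r st2 st3 -> keep s r st1 st3.
Proof. by move=> keep12 keep23 q lq; rewrite keep23 ?keep12. Qed.

Lemma keep_set_reg q a st st' :
  ~~ live s r q -> keep s r st st' -> keep s r st (set_reg st' q a).
Proof.
move=> dead keep_st q' lq'; rewrite /= upd_other ?keep_st // => eqq.
by rewrite -eqq lq' in dead.
Qed.

Lemma keep_sub s' r' st st' :
  {subset s <= s'} -> r <= r' -> keep s' r' st st' -> keep s r st st'.
Proof.
move=> ss' rr' keep_st q lq; apply: keep_st; move: lq; rewrite /live /tmp.
by case: ifP => _; [apply: ss' | lia].
Qed.

Lemma keep_unbind x r' st st' : r <= r' -> keep (x :: s) r' st st' -> keep s r st st'.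
Proof. by move=> rr'; apply: keep_sub => // y ys; apply: mem_behead. Qed.

End Live.

Definition loop (x r : nat) (body : ram) : ram :=
  Seq (copy_reg (tmp r) order_reg)
  (Seq (Const (var_reg x) 0)
  (Seq (Const (row_reg x) 0)
  (While (tmp r)
    (Seq body
    (Seq (Const (tmp r.+1) 1)
    (Seq (Add (var_reg x) (var_reg x) (tmp r.+1))
    (Seq (Add (row_reg x) (row_reg x) order_reg)
         (Sub (tmp r) (tmp r) (tmp r.+1))))))))).

(* Leaves the address of the cell in the temporary [r]: tables occupy the memory from
   address 2 on, by rows, so that table 0 initially is the adjacency matrix. *)
Definition cell_addr (r k x y : nat) : ram :=
  Seq (Const (tmp r) 2)
  (Seq (add_times k (tmp r) area_reg)
  (Seq (Add (tmp r) (tmp r) (row_reg x)) (Add (tmp r) (tmp r) (var_reg y)))).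

Fixpoint comp_expr (r : nat) (e : expr) : ram :=
  match e with
  | Lit a => Const (tmp r) a
  | VertexCount => copy_reg (tmp r) order_reg
  | Budget => copy_reg (tmp r) budget_reg
  | Var x => copy_reg (tmp r) (var_reg x)
  | Plus a b => Seq (comp_expr r a)
      (Seq (comp_expr r.+1 b) (Add (tmp r) (tmp r) (tmp r.+1)))
  | Minus a b => Seq (comp_expr r a)
      (Seq (comp_expr r.+1 b) (Sub (tmp r) (tmp r) (tmp r.+1)))
  | Get k x y => Seq (cell_addr r k x y) (Read (tmp r) (tmp r))
  | Cond a b c => Seq (comp_expr r a) (If (tmp r) (comp_expr r b) (comp_expr r c))
  | Sum x a => Seq (Const (tmp r) 0)
      (loop x r.+1 (Seq (comp_expr r.+2 a) (Add (tmp r) (tmp r) (tmp r.+2))))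
  end.

Fixpoint comp_cmd (r : nat) (c : cmd) : ram :=
  match c with
  | Tabulate k x y e =>
      loop x r (loop y r.+1
        (Seq (comp_expr r.+2 e)
        (Seq (cell_addr r.+3 k x y) (Write (tmp r.+3) (tmp r.+2)))))
  | Then c1 c2 => Seq (comp_cmd r c1) (comp_cmd r c2)
  | For x c => loop x r (comp_cmd r.+1 c)
  end.

Definition loop_cost (n B : nat) : nat :=
  2 + (1 + (1 + (n * (B + (1 + (1 + (1 + 1)))).+1).+1)).

Definition cell_addr_cost (k : nat) : nat := 1 + (k.+1 + (1 + 1)).

Fixpoint expr_cost (n : nat) (e : expr) : nat :=
  match e with
  | Lit _ => 1
  | VertexCount | Budget | Var _ => 2
  | Plus a b | Minus a b => expr_cost n a + (expr_cost n b + 1)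
  | Get k _ _ => cell_addr_cost k + 1
  | Cond a b c => expr_cost n a + (expr_cost n b + expr_cost n c).+1
  | Sum _ a => 1 + loop_cost n (expr_cost n a + 1)
  end.

Fixpoint cmd_cost (n : nat) (c : cmd) : nat :=
  match c with
  | Tabulate k _ _ e =>
      loop_cost n (loop_cost n (expr_cost n e + (cell_addr_cost k + 1)))
  | Then c1 c2 => cmd_cost n c1 + cmd_cost n c2
  | For _ c => loop_cost n (cmd_cost n c)
  end.

Section Correctness.

Variables (n K : nat).
Implicit Types (s : seq nat) (env : nat -> nat) (T : tables) (st : ram_state).

Ltac simpl_regs := rewrite /=;
  repeat first [rewrite upd_same
               | rewrite upd_other;
                 last by rewrite /tmp /var_reg /row_reg /order_reg; lia].

Ltac keep_set_regs :=
  repeat (apply: keep_set_reg; first by rewrite liveE -?leqNgt ?leqnn ?leqnSn).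

Lemma runs_loop s x r body B (I : nat -> ram_state -> Prop) st0 :
  x \notin s ->
  (forall i st st', keep s r st st' -> mem st' = mem st -> I i st -> I i st') ->
  (forall i st, I i st -> reg st order_reg = n) ->
  (forall i st,
     i < n -> reg st (var_reg x) = i -> reg st (row_reg x) = i * n -> I i st ->
     runs body st B (fun st' => I i.+1 st' /\
       {in [:: tmp r; var_reg x; row_reg x], reg st' =1 reg st})) ->
  I 0 st0 -> runs (loop x r body) st0 (loop_cost n B) (I n).
Proof.
move=> xs Ikeep Iorder run_body I0.
pose J a st := [/\ reg st (tmp r) = a, a <= n, I (n - a) st,
  reg st (var_reg x) = n - a & reg st (row_reg x) = (n - a) * n].
have order0 := Iorder _ _ I0.
apply: runs_seq; apply: runs_copy_reg; first by rewrite /tmp /order_reg; lia.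
apply/runs_seq/runs_const/runs_seq/runs_const.
apply: (@runs_weaken _ _ _ (J 0)) => [|st [_ _]]; last by rewrite subn0.
apply: (runs_while (I := J)) =>
    [a st [] //|a st [st_a a_le Ist st_x st_row]|]; last first.
  split; [by simpl_regs | exact: leqnn | | by simpl_regs; rewrite subnn..].
  by rewrite subnn; apply: Ikeep I0 => //; keep_set_regs.
have lt_n : n - a.+1 < n by lia.
apply/runs_seq/(runs_weaken (run_body _ _ lt_n st_x st_row Ist)) => st' [I' same].
have [] : [/\ reg st' (tmp r) = a.+1, reg st' (var_reg x) = n - a.+1
    & reg st' (row_reg x) = (n - a.+1) * n].
  by split; rewrite same ?inE ?eqxx ?orbT.
move=> st'_a st'_x st'_row; have order' := Iorder _ _ I'.
apply/runs_seq/runs_const/runs_seq/runs_add/runs_seq/runs_add/runs_sub.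
rewrite /J (_ : n - a = (n - a.+1).+1); last by lia.
split; [by simpl_regs; lia | exact: ltnW | | by simpl_regs; rewrite st'_x addn1 |].
  by apply: Ikeep I' => //; keep_set_regs.
by simpl_regs; rewrite st'_row order' mulSn addnC.
Qed.

Lemma keep_loop_regs s x r st st' : keep (x :: s) r.+1 st st' ->
  {in [:: tmp r; var_reg x; row_reg x], reg st' =1 reg st}.
Proof.
by move=> keep_st q; rewrite !inE => /or3P[] /eqP->; apply: keep_st;
  rewrite liveE ?mem_head ?ltnSn.
Qed.

Definition cell (k i j : nat) : nat := 2 + (k * (n * n) + (i * n + j)).

Lemma eq_cell k i j k' i' j' : i < n -> j < n -> i' < n -> j' < n ->
  (cell k i j == cell k' i' j') = [&& k == k', i == i' & j == j'].
Proof.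
move=> lti ltj lti' ltj'.
have lt_nn a b : a < n -> b < n -> a * n + b < n * n by nia.
by rewrite /cell eqn_add2l !eqn_mulD_small ?lt_nn.
Qed.

Definition agrees (m : nat -> nat) (T : tables) : Prop :=
  forall k i j, i < n -> j < n -> m (cell k i j) = T k i j.

Definition overwrite (k : nat) (done : rel nat) (val : nat -> nat -> nat)
    (T : tables) : tables :=
  fun k' i j => if (k' == k) && done i j then val i j else T k' i j.

Lemma agrees_overwrite m k (done done' : rel nat) val T :
  (forall i j, i < n -> j < n -> done i j = done' i j) ->
  agrees m (overwrite k done val T) -> agrees m (overwrite k done' val T).
Proof.
by move=> eq_done agree k' i j lti ltj; rewrite agree // /overwrite eq_done.
Qed.

Lemma agrees_upd m k i j done val T : i < n -> j < n ->
  agrees m (overwrite k done val T) ->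
  agrees (upd m (cell k i j) (val i j))
    (overwrite k (fun a b => done a b || (a == i) && (b == j)) val T).
Proof.
move=> lti ltj agree k' a b lta ltb; rewrite /upd eq_cell //.
case: ifP => [/and3P[/eqP-> /eqP-> /eqP->]|other]; first by rewrite /overwrite !eqxx orbT.
rewrite agree // /overwrite; move: other.
by case: (k' == k) (done a b) (a == i) (b == j) => [] [] [] [].
Qed.

Record represents s env st : Prop := Represents {
  represents_order : reg st order_reg = n;
  represents_area : reg st area_reg = n * n;
  represents_budget : reg st budget_reg = K;
  represents_var : forall x, x \in s ->
    [/\ env x < n, reg st (var_reg x) = env x & reg st (row_reg x) = env x * n]
}.

Lemma represents_keep s r env st st' :
  keep s r st st' -> represents s env st -> represents s env st'.
Proof.
move=> keep_st [stn stnn stK st_var]; split; rewrite ?keep_st ?liveE // => x xs.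
by rewrite !keep_st ?liveE //; apply: st_var.
Qed.

Lemma represents_bind s env x st i :
  represents s env st -> i < n ->
  reg st (var_reg x) = i -> reg st (row_reg x) = i * n ->
  represents (x :: s) (upd env x i) st.
Proof.
move=> [stn stnn stK st_var] lti st_x st_row; split=> // y.
rewrite inE /upd; case: eqP => [-> _|_ /= ys]; first by [].
exact: st_var.
Qed.

Definition computes s r (c : ram) st (B v : nat) : Prop :=
  runs c st B (fun st' => [/\ keep s r st st', mem st' = mem st & reg st' (tmp r) = v]).

Lemma computes_copy_reg s r i st :
  tmp r != i -> computes s r (copy_reg (tmp r) i) st 2 (reg st i).
Proof.
move=> /eqP ri; apply: runs_copy_reg => //; split=> //; last by simpl_regs.
by keep_set_regs.
Qed.

Lemma computes_binop s r env st c1 c2 B1 B2 v1 v2 (op : nat -> nat -> nat) instr :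
  (forall st Q, Q (set_reg st (tmp r) (op (reg st (tmp r)) (reg st (tmp r.+1)))) ->
    runs instr st 1 Q) ->
  represents s env st ->
  computes s r c1 st B1 v1 ->
  (forall st', represents s env st' -> mem st' = mem st ->
    computes s r.+1 c2 st' B2 v2) ->
  computes s r (Seq c1 (Seq c2 instr)) st (B1 + (B2 + 1)) (op v1 v2).
Proof.
move=> run_instr repr_st run1 run2.
apply/runs_seq/(runs_weaken run1) => st1 [keep1 memE1 v1E].
have repr1 := represents_keep keep1 repr_st.
apply/runs_seq/(runs_weaken (run2 st1 repr1 memE1)) => st2 [keep2 memE2 v2E].
apply: run_instr; split=> [||/=]; last by rewrite upd_same v2E keep2 ?liveE // v1E.
  apply: keep_set_reg; first by rewrite liveE ltnn.
  by apply: keep_trans keep1 _; apply: keep_sub keep2.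
by rewrite /= memE2.
Qed.

Lemma computes_cond s r env st c1 c2 c3 B1 B2 B3 v1 v2 v3 :
  represents s env st ->
  computes s r c1 st B1 v1 ->
  (forall st', represents s env st' -> mem st' = mem st -> computes s r c2 st' B2 v2) ->
  (forall st', represents s env st' -> mem st' = mem st -> computes s r c3 st' B3 v3) ->
  computes s r (Seq c1 (If (tmp r) c2 c3)) st (B1 + (B2 + B3).+1)
    (if v1 != 0 then v2 else v3).
Proof.
move=> repr_st run1 run2 run3; apply/runs_seq/(runs_weaken run1) => st1 [keep1 memE1 v1E].
have repr1 := represents_keep keep1 repr_st; apply: runs_if; rewrite v1E => v1_test.
  apply: runs_weaken (run2 st1 repr1 memE1) _ => st2 [keep2 memE2 v2E].
  by rewrite v1_test memE2; split=> //; apply: keep_trans keep1 keep2.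
apply: runs_weaken (run3 st1 repr1 memE1) _ => st2 [keep2 memE2 v2E].
by rewrite v1_test memE2; split=> //; apply: keep_trans keep1 keep2.
Qed.

Lemma computes_sum s x r env st c B (F : nat -> nat) :
  x \notin s -> represents s env st ->
  (forall i st', i < n -> represents (x :: s) (upd env x i) st' -> mem st' = mem st ->
    computes (x :: s) r.+2 c st' B (F i)) ->
  computes s r
    (Seq (Const (tmp r) 0) (loop x r.+1 (Seq c (Add (tmp r) (tmp r) (tmp r.+2)))))
    st (1 + loop_cost n (B + 1)) (\sum_(i < n) F i).
Proof.
move=> xs repr_st run_c; apply/runs_seq/runs_const.
pose I i st' := [/\ keep s r st st', mem st' = mem st
  & reg st' (tmp r) = \sum_(j < i) F j].
apply: (runs_loop (I := I) xs) =>
    [i st1 st2 keep12 memE12 [keep1 memE1 sum1]|i st1 [keep1 _ _]|i st1|].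
- split; [|by rewrite memE12|by rewrite keep12 ?liveE].
  by apply: keep_trans keep1 _; apply: keep_sub keep12.
- exact: represents_order (represents_keep keep1 repr_st).
- move=> lti st1_x st1_row [keep1 memE1 sum1].
  have repr1 := represents_bind (represents_keep keep1 repr_st) lti st1_x st1_row.
  apply/runs_seq/(runs_weaken (run_c i st1 lti repr1 memE1)) => st2 [keep2 memE2 v2].
  have keep12 : keep s r st1 st2 by apply: keep_unbind keep2; lia.
  apply/runs_add; split; last first.
    move=> q /[dup] /(keep_loop_regs keep2) <-; rewrite /= => q_loop.
    rewrite upd_other // => qE; move: q_loop.
    by rewrite qE !inE /tmp /var_reg /row_reg; lia.
  split; [|by rewrite /= memE2|].
    by apply: keep_set_reg; [rewrite liveE ltnn|apply: keep_trans keep1 keep12].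
  by simpl_regs; rewrite v2 keep2 ?liveE ?leqnSn // sum1 big_ord_recr.
- by split; [keep_set_regs| |rewrite big_ord0; simpl_regs].
Qed.

Lemma computes_cell_addr s r env k x y st :
  x \in s -> y \in s -> represents s env st ->
  computes s r (cell_addr r k x y) st (cell_addr_cost k) (cell k (env x) (env y)).
Proof.
move=> xs ys repr_st; apply/runs_seq/runs_const/runs_seq.
apply: runs_weaken (runs_add_times _ _ _) _; first by rewrite /tmp /area_reg; lia.
move=> st1; simpl_regs; rewrite upd_other; last by rewrite /tmp /area_reg; lia.
move=> [st1_r memE1 other]; apply/runs_seq/runs_add/runs_add.
have [_ st_y _] := represents_var repr_st ys.
have [_ _ st_x] := represents_var repr_st xs.
have stnn := represents_area repr_st; split=> //.
  keep_set_regs => q lq; have q_r : q <> tmp r by move=> qE; rewrite qE liveE ltnn in lq.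
  by rewrite other // upd_other.
simpl_regs; rewrite st1_r !other; try by rewrite /tmp /row_reg /var_reg; lia.
by simpl_regs; rewrite stnn st_x st_y /cell -!addnA.
Qed.

Lemma comp_expr_correct e s r env T st :
  wf_expr s e -> represents s env st -> agrees (mem st) T ->
  computes s r (comp_expr r e) st (expr_cost n e) (eval n K T env e).
Proof.
elim: e s r env st => [a|||x|a IHa b IHb|a IHa b IHb|k x y|a IHa b IHb c IHc|x a IHa]
    s r env st /=.
- by move=> _ repr_st agree; apply: runs_const; split; [keep_set_regs| |simpl_regs].
- move=> _ repr_st agree; rewrite -[X in computes _ _ _ _ _ X](represents_order repr_st).
  by apply: computes_copy_reg; rewrite /tmp /order_reg; lia.
- move=> _ repr_st agree; rewrite -[X in computes _ _ _ _ _ X](represents_budget repr_st).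
  by apply: computes_copy_reg; rewrite /tmp /budget_reg; lia.
- move=> xs repr_st agree; have [_ <- _] := represents_var repr_st xs.
  by apply: computes_copy_reg; rewrite /tmp /var_reg; lia.
- move=> /andP[wfa wfb] repr_st agree.
  apply: (computes_binop (op := addn) _ repr_st (IHa _ _ _ _ wfa repr_st agree)).
    exact: runs_add.
  by move=> st' repr' memE'; apply: IHb; rewrite ?memE'.
- move=> /andP[wfa wfb] repr_st agree.
  apply: (computes_binop (op := subn) _ repr_st (IHa _ _ _ _ wfa repr_st agree)).
    exact: runs_sub.
  by move=> st' repr' memE'; apply: IHb; rewrite ?memE'.
- move=> /andP[xs ys] repr_st agree.
  apply/runs_seq/(runs_weaken (computes_cell_addr r k xs ys repr_st)) =>
    st1 [keep1 memE1 addr].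
  apply: runs_read; split=> //; first by apply: keep_set_reg; rewrite ?liveE ?ltnn.
  have [ltx _ _] := represents_var repr_st xs.
  have [lty _ _] := represents_var repr_st ys.
  by rewrite /= upd_same addr memE1 agree.
- move=> /and3P[wfa wfb wfc] repr_st agree.
  by apply: (computes_cond repr_st (IHa _ _ _ _ wfa repr_st agree)) => st' repr' memE';
    [apply: IHb|apply: IHc]; rewrite ?memE'.
- move=> /andP[xs wfa] repr_st agree; pose F i := eval n K T (upd env x i) a.
  apply: (computes_sum (F := F) xs repr_st) => i st' lti repr' memE'.
  by apply: IHa; rewrite ?memE'.
Qed.

Definition transforms s r (c : ram) st (B : nat) T : Prop :=
  runs c st B (fun st' => keep s r st st' /\ agrees (mem st') T).

Lemma transforms_agrees s r c st B T T' :
  transforms s r c st B T -> (forall m, agrees m T -> agrees m T') ->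
  transforms s r c st B T'.
Proof.
move=> run_c TT'; apply: runs_weaken run_c _ => st' [keep_st agree].
by split=> //; apply: TT'.
Qed.

Lemma transforms_loop s x r env st c B (T : nat -> tables) :
  x \notin s -> represents s env st -> agrees (mem st) (T 0) ->
  (forall i st',
    i < n -> represents (x :: s) (upd env x i) st' -> agrees (mem st') (T i) ->
    transforms (x :: s) r.+1 c st' B (T i.+1)) ->
  transforms s r (loop x r c) st (loop_cost n B) (T n).
Proof.
move=> xs repr_st agree run_c.
apply: (runs_loop (I := fun i st' => keep s r st st' /\ agrees (mem st') (T i)) xs) =>
    [i st1 st2 keep12 memE12 [keep1 agree1]|i st1 [keep1 _]
    |i st1 lti st1_x st1_row [keep1 agree1]|//].
- by rewrite memE12; split=> //; apply: keep_trans keep1 keep12.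
- exact: represents_order (represents_keep keep1 repr_st).
have repr1 := represents_bind (represents_keep keep1 repr_st) lti st1_x st1_row.
apply: runs_weaken (run_c i st1 lti repr1 agree1) _ => st2 [keep2 agree2].
split; last exact: keep_loop_regs keep2.
by split=> //; apply: keep_trans keep1 _; apply: keep_unbind keep2.
Qed.

Lemma comp_cell_correct s r env k x y e st done (val : nat -> nat -> nat) T :
  x \in s -> y \in s -> wf_expr s e -> represents s env st ->
  agrees (mem st) (overwrite k done val T) ->
  eval n K (overwrite k done val T) env e = val (env x) (env y) ->
  transforms s r
    (Seq (comp_expr r e) (Seq (cell_addr r.+1 k x y) (Write (tmp r.+1) (tmp r))))
    st (expr_cost n e + (cell_addr_cost k + 1))
    (overwrite k (fun a b => done a b || (a == env x) && (b == env y)) val T).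
Proof.
move=> xs ys wfe repr_st agree eval_e.
apply/runs_seq/(runs_weaken (comp_expr_correct r wfe repr_st agree)) =>
  st1 [keep1 memE1 v1].
have repr1 := represents_keep keep1 repr_st.
apply/runs_seq/(runs_weaken (computes_cell_addr r.+1 k xs ys repr1)) =>
  st2 [keep2 memE2 addr].
apply: runs_write; split; first by apply: keep_trans keep1 _; apply: keep_sub keep2.
rewrite /= addr keep2 ?liveE // v1 memE2 memE1 eval_e.
have [ltx _ _] := represents_var repr_st xs; have [lty _ _] := represents_var repr_st ys.
exact: agrees_upd.
Qed.

Lemma comp_tabulate_correct s r env k x y e st T :
  wf_cmd s (Tabulate k x y e) -> represents s env st -> agrees (mem st) T ->
  transforms s r (comp_cmd r (Tabulate k x y e)) st (cmd_cost n (Tabulate k x y e))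
    (exec n K env (Tabulate k x y e) T).
Proof.
move=> /and4P[xs ys wfe noread] repr_st agree.
have x_neq_y : x <> y by move=> xy; rewrite xy mem_head in ys.
pose val i j := eval n K T (upd (upd env x i) y j) e.
pose rows i := overwrite k (fun a _ => a < i) val T.
pose cells i j := overwrite k (fun a b => (a < i) || (a == i) && (b < j)) val T.
pose write_cell := Seq (comp_expr r.+2 e) (Seq (cell_addr r.+3 k x y)
  (Write (tmp r.+3) (tmp r.+2))).
have cell_written i j st2 : represents [:: y, x & s] (upd (upd env x i) y j) st2 ->
    agrees (mem st2) (cells i j) -> transforms [:: y, x & s] r.+2 write_cell st2
      (expr_cost n e + (cell_addr_cost k + 1)) (cells i j.+1).
  move=> repr2 agree2.
  have := comp_cell_correct (x := x) (y := y) r.+2 _ _ wfe repr2 agree2.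
  rewrite !inE !eqxx orbT upd_other // !upd_same => run_cell.
  apply: transforms_agrees (run_cell _ _ _) _ => // [|m].
    apply: eval_eq_tables => k' a b rd; rewrite /overwrite.
    by case: eqP => //= kk'; rewrite -kk' rd in noread.
  apply: agrees_overwrite => a b _ _.
  by rewrite ltnS (leq_eqVlt b) -orbA -andb_orr [(b < j) || _]orbC.
have row_written i st1 : represents (x :: s) (upd env x i) st1 ->
    agrees (mem st1) (rows i) -> transforms (x :: s) r.+1 (loop y r.+1 write_cell) st1
      (loop_cost n (expr_cost n e + (cell_addr_cost k + 1))) (rows i.+1).
  move=> repr1 agree1; have ag_start : agrees (mem st1) (cells i 0).
    by apply: agrees_overwrite agree1 => a b _ _; rewrite andbF orbF.
  apply: transforms_agrees (transforms_loop (T := cells i) ys repr1 ag_start _) _.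
    by move=> j st2 _; apply: cell_written.
  move=> m; apply: agrees_overwrite => a b _ ltb.
  by rewrite ltb andbT ltnS (leq_eqVlt a) orbC.
apply: transforms_agrees (transforms_loop (T := rows) xs repr_st _ _) _ =>
    [k' a b lta ltb||].
- by rewrite /rows /overwrite andbF; apply: agree.
- by move=> i st1 _; apply: row_written.
- by move=> m agree' k' a b lta ltb; rewrite agree' // /rows /overwrite lta andbT.
Qed.

Lemma comp_cmd_correct c s r env T st :
  wf_cmd s c -> represents s env st -> agrees (mem st) T ->
  transforms s r (comp_cmd r c) st (cmd_cost n c) (exec n K env c T).
Proof.
elim: c s r env T st => [k x y e|c1 IH1 c2 IH2|x c IH] s r env T st.
- exact: comp_tabulate_correct.
- move=> /andP[wf1 wf2] repr_st agree.
  apply/runs_seq/(runs_weaken (IH1 s r env T st wf1 repr_st agree)) => st1 [keep1 agree1].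
  have repr1 := represents_keep keep1 repr_st.
  apply: runs_weaken (IH2 s r env _ st1 wf2 repr1 agree1) _ => st2 [keep2 agree2].
  by split=> //; apply: keep_trans keep1 keep2.
- move=> /andP[xs wfc] repr_st agree.
  pose rounds m := iteri m (fun i => exec n K (upd env x i) c) T.
  apply: (transforms_loop (T := rounds) xs repr_st) => // i st' lti repr' agree'.
  exact: IH.
Qed.

End Correctness.

(** * Polynomial running time *)

Definition poly_bounded (f : nat -> nat) : Prop :=
  exists a d, forall n, f n <= a * n.+1 ^ d.

Lemma poly_bounded_cst a : poly_bounded (fun=> a).
Proof. by exists a, 0 => n; rewrite expn0 muln1. Qed.

Lemma poly_bounded_id : poly_bounded id.
Proof. by exists 1, 1 => n; rewrite expn1 mul1n. Qed.

Lemma poly_bounded_add f g :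
  poly_bounded f -> poly_bounded g -> poly_bounded (fun n => f n + g n).
Proof.
move=> [a [d fa]] [b [e gb]]; exists (a + b), (d + e) => n.
rewrite mulnDl; apply: leq_add; [apply: leq_trans (fa n) _|apply: leq_trans (gb n) _];
  by rewrite leq_mul2l leq_pexp2l ?orbT // ?leq_addr ?leq_addl.
Qed.

Lemma poly_bounded_mul f g :
  poly_bounded f -> poly_bounded g -> poly_bounded (fun n => f n * g n).
Proof.
move=> [a [d fa]] [b [e gb]]; exists (a * b), (d + e) => n.
by rewrite expnD mulnACA leq_mul.
Qed.

Lemma poly_bounded_succ f : poly_bounded f -> poly_bounded (fun n => (f n).+1).
Proof. exact: poly_bounded_add (poly_bounded_cst 1). Qed.

Lemma poly_bounded_loop_cost f :
  poly_bounded f -> poly_bounded (fun n => loop_cost n (f n)).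
Proof.
rewrite /loop_cost; eauto 12 using poly_bounded_cst, poly_bounded_id, poly_bounded_succ,
  poly_bounded_add, poly_bounded_mul.
Qed.

Lemma poly_bounded_expr_cost e : poly_bounded (fun n => expr_cost n e).
Proof.
elim: e => /=; by eauto 8 using poly_bounded_cst, poly_bounded_succ, poly_bounded_add,
  poly_bounded_loop_cost.
Qed.

Lemma poly_bounded_cmd_cost c : poly_bounded (fun n => cmd_cost n c).
Proof.
elim: c => /=; by eauto 8 using poly_bounded_cst, poly_bounded_add,
  poly_bounded_loop_cost, poly_bounded_expr_cost.
Qed.

Section Encoding.

Variable x : instance.

Lemma size_encode : size (encode x) = order x * order x + 2.
Proof. by rewrite /= size_allpairs size_enum_ord addn2. Qed.

Lemma nth_encode_adj (i j : 'I_(order x)) :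
  nth 0 (encode x) (i * order x + j).+2 = adj (graph x) i j.
Proof.
have /= := @nth_allpairs _ _ _ (fun u v => adj (graph x) u v : nat)
  (enum 'I_(order x)) (enum 'I_(order x)) i j 0 i j.
by rewrite size_enum_ord !nth_ord_enum; apply.
Qed.

Lemma order_lt_bit_size : order x < bit_size (encode x).
Proof.
have : size (encode x) <= bit_size (encode x).
  by rewrite /bit_size -sum1_size; apply: leq_sum.
by rewrite size_encode; apply: leq_trans; nia.
Qed.

End Encoding.

Definition prologue : ram :=
  Seq (Const (tmp 0) 0) (Seq (Read order_reg (tmp 0))
  (Seq (Const (tmp 0) 1) (Seq (Read budget_reg (tmp 0))
  (Seq (Const area_reg 0) (loop 0 0 (Add area_reg area_reg order_reg)))))).

Definition epilogue : ram :=
  Seq (copy_reg 0 (tmp 2))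
  (Seq (Const (tmp 2) 0) (Seq (Write (tmp 2) (tmp 0))
  (Seq (Const (tmp 2) 1) (Write (tmp 2) (tmp 1))))).

Definition prologue_cost (n : nat) : nat := 1 + (1 + (1 + (1 + (1 + loop_cost n 1)))).

Definition epilogue_cost : nat := 2 + (1 + (1 + (1 + 1))).

Section Prologue.

Variable x : instance.
Let n := order x.
Let K := budget x.

Lemma runs_prologue : runs prologue (ram_input (encode x)) (prologue_cost n) (fun st =>
  represents n K [::] (fun=> 0) st /\ mem st = nth 0 (encode x)).
Proof.
apply/runs_seq/runs_const/runs_seq/runs_read/runs_seq/runs_const/runs_seq/runs_read.
apply/runs_seq/runs_const; set st0 := set_reg _ area_reg _.
pose I i st := [/\ reg st order_reg = n, reg st area_reg = i * n, reg st budget_reg = K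
  & mem st = nth 0 (encode x)].
apply: (@runs_weaken _ _ _ (I n)) => [|st [st_n st_nn st_K st_mem]]; last by split.
apply: (@runs_loop n [::] 0 0 _ _ I) => //
    [i st st' keep_st mem_st|i st []|i st lti _ _] //.
  by move=> [st_n st_nn st_K st_mem]; split; rewrite ?mem_st ?keep_st ?liveE.
move=> [st_n st_nn st_K st_mem]; apply: runs_add; split.
  by split; rewrite //= upd_same st_n st_nn mulSn addnC.
by move=> q; rewrite !inE => /or3P[] /eqP->.
Qed.

End Prologue.

Lemma runs_epilogue st : runs epilogue st epilogue_cost (fun st' =>
  [/\ reg st' 0 = reg st (tmp 2), mem st' 0 = reg st (tmp 0), mem st' 1 = reg st (tmp 1)
    & forall q, mem st' q.+2 = mem st q.+2]).
Proof.
apply: runs_seq; apply: runs_copy_reg => //.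
by apply/runs_seq/runs_const/runs_seq/runs_write/runs_seq/runs_const/runs_write.
Qed.

Definition input_tables (x : instance) : tables :=
  fun k i j => nth 0 (encode x) (cell (order x) k i j).

Definition output_tables (c : cmd) (x : instance) : tables :=
  exec (order x) (budget x) (fun=> 0) c (input_tables x).

Definition output_value (c : cmd) (e : expr) (x : instance) : nat :=
  eval (order x) (budget x) (output_tables c x) (fun=> 0) e.

Section TableMachine.

Variables (c : cmd) (order_e budget_e length_e : expr).
Hypotheses (wf_c : wf_cmd [::] c) (wf_order : wf_expr [::] order_e)
  (wf_budget : wf_expr [::] budget_e) (wf_length : wf_expr [::] length_e).

Definition table_machine : ram :=
  Seq prologue (Seq (comp_cmd 0 c)
  (Seq (comp_expr 0 order_e) (Seq (comp_expr 1 budget_e)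
  (Seq (comp_expr 2 length_e) epilogue)))).

Definition table_machine_cost (n : nat) : nat :=
  prologue_cost n + (cmd_cost n c + (expr_cost n order_e + (expr_cost n budget_e +
  (expr_cost n length_e + epilogue_cost)))).

Lemma poly_bounded_table_machine_cost : poly_bounded table_machine_cost.
Proof.
rewrite /table_machine_cost /prologue_cost.
eauto 15 using poly_bounded_cst, poly_bounded_add, poly_bounded_loop_cost,
  poly_bounded_expr_cost, poly_bounded_cmd_cost.
Qed.

Lemma runs_table_machine x (n := order x) :
  runs table_machine (ram_input (encode x)) (table_machine_cost n) (fun st =>
    [/\ reg st 0 = output_value c length_e x, mem st 0 = output_value c order_e x,
       mem st 1 = output_value c budget_e x
     & forall i j, i < n -> j < n -> mem st (i * n + j).+2 = output_tables c x 0 i j]).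
Proof.
apply/runs_seq/(runs_weaken (runs_prologue x)) => st0 [repr0 memE0].
have agree0 : agrees n (mem st0) (input_tables x) by rewrite memE0.
apply/runs_seq/(runs_weaken (comp_cmd_correct 0 wf_c repr0 agree0)) => st1 [keep1 agree1].
have repr1 := represents_keep keep1 repr0.
apply/runs_seq/(runs_weaken (comp_expr_correct 0 wf_order repr1 agree1)) =>
  st2 [keep2 memE2 v2].
have repr2 := represents_keep keep2 repr1; rewrite -memE2 in agree1.
apply/runs_seq/(runs_weaken (comp_expr_correct 1 wf_budget repr2 agree1)) =>
  st3 [keep3 memE3 v3].
have repr3 := represents_keep keep3 repr2; rewrite -memE3 in agree1.
apply/runs_seq/(runs_weaken (comp_expr_correct 2 wf_length repr3 agree1)) =>
  st4 [keep4 memE4 v4].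
apply: runs_weaken (runs_epilogue st4) _ => st5 [-> -> -> memE5].
rewrite v4 (keep4 (tmp 1)) ?liveE // v3 (keep4 (tmp 0)) ?liveE // keep3 ?liveE // v2.
by split=> // i j lti ltj; rewrite memE5 memE4; apply: (agree1 0 i j).
Qed.

Lemma table_machine_poly_time (f : instance -> instance) :
  (forall x, [/\ output_value c order_e x = order (f x),
     output_value c budget_e x = budget (f x),
     output_value c length_e x = size (encode (f x)), order (f x) <= order x
   & forall i j, i < order x -> j < order x ->
       i * order x + j < order (f x) * order (f x) ->
       output_tables c x 0 i j = nth 0 (encode (f x)) (i * order x + j).+2]) ->
  poly_time f.
Proof.
move=> f_spec; have [a [d cost_le]] := poly_bounded_table_machine_cost.
exists table_machine, a, d => x; set n := order x.
have [t [st [ex t_le [st_len st0 st1 st_tab]]]] := runs_table_machine x.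
have [nE kE lE le_order tabE] := f_spec x; exists t, st; split=> //; last first.
  apply: leq_trans t_le (leq_trans (cost_le n) _); rewrite leq_mul2l.
  by case: (d) => [|e]; rewrite ?leqnn ?leq_exp2r ?order_lt_bit_size ?orbT.
split=> [|[_|[_|q]]]; [by rewrite st_len lE|by rewrite st0 nE|by rewrite st1 kE|].
rewrite size_encode addn2 !ltnS -[_ < _]/(q < _) => lt_q.
have lt_nn : q < n * n by apply: leq_trans lt_q (leq_mul le_order le_order).
have n_gt0 : 0 < n by case: (n) lt_nn.
have lt_i : q %/ n < n by rewrite ltn_divLR.
have lt_j : q %% n < n by rewrite ltn_mod.
by rewrite (divn_eq q n) st_tab // tabE -?divn_eq.
Qed.

End TableMachine.

(** * The kernel as a table program *)

Definition lt_expr (a b : expr) : expr := Cond (Minus b a) (Lit 1) (Lit 0).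
Definition and_expr (a b : expr) : expr := Cond a (Cond b (Lit 1) (Lit 0)) (Lit 0).
Definition or_expr (a b : expr) : expr := Cond a (Lit 1) (Cond b (Lit 1) (Lit 0)).
Definition not_expr (a : expr) : expr := Cond a (Lit 0) (Lit 1).
Definition eq_expr (a b : expr) : expr :=
  not_expr (or_expr (lt_expr a b) (lt_expr b a)).
Definition exists_expr (x : nat) (a : expr) : expr := Cond (Sum x a) (Lit 1) (Lit 0).

Declare Scope expr_scope.
Delimit Scope expr_scope with expr.
Bind Scope expr_scope with expr.
Notation "a + b" := (Plus a b) : expr_scope.
Notation "a - b" := (Minus a b) : expr_scope.
Notation "a < b" := (lt_expr a b) : expr_scope.
Notation "a == b" := (eq_expr a b) : expr_scope.
Notation "a && b" := (and_expr a b) : expr_scope.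
Notation "a || b" := (or_expr a b) : expr_scope.
Notation "~~ a" := (not_expr a) : expr_scope.

(* The product, provided that [a] is at most the number of vertices. *)
Definition mul_expr (z : nat) (a b : expr) : expr := Sum z (Cond (Var z < a) b (Lit 0)).

Definition rank_expr (z : nat) (a : expr) (x : nat) : expr :=
  Sum z (a && (Var z < Var x)).

Definition degree_expr (z k x : nat) : expr := Sum z (Get k x z).

Definition arcs_expr (y z k : nat) : expr := Sum y (degree_expr z k y).

Section EvalOperators.

Variables (n K : nat) (T : tables) (env : nat -> nat).
Notation ev := (eval n K T env).

Lemma eval_cond a b c : ev (Cond a b c) = if ev a != 0 then ev b else ev c.
Proof. by []. Qed.

Lemma eval_sum x a : ev (Sum x a) = \sum_(i < n) eval n K T (upd env x i) a.
Proof. by []. Qed.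

Lemma eval_plus a b : ev (a + b)%expr = ev a + ev b.
Proof. by []. Qed.

Lemma eval_lt a b : ev (a < b)%expr = (ev a < ev b).
Proof. by rewrite /= subn_eq0 -ltnNge; case: ltnP. Qed.

Lemma eval_and a b : ev (a && b)%expr = (ev a != 0) && (ev b != 0).
Proof. by rewrite /=; case: (ev a != 0) (ev b != 0) => [] []. Qed.

Lemma eval_or a b : ev (a || b)%expr = (ev a != 0) || (ev b != 0).
Proof. by rewrite /=; case: (ev a != 0) (ev b != 0) => [] []. Qed.

Lemma eval_not a : ev (~~ a)%expr = (ev a == 0).
Proof. by rewrite /=; case: (ev a == 0). Qed.

Lemma eval_eq a b : ev (a == b)%expr = (ev a == ev b).
Proof. by rewrite eval_not eval_or !eval_lt; case: ltngtP. Qed.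

End EvalOperators.

Section EvalBinders.

Variables (n K : nat) (T : tables) (env : nat -> nat).

Lemma eval_exists x a (P : pred 'I_n) :
  (forall i : 'I_n, eval n K T (upd env x i) a = P i) ->
  eval n K T env (exists_expr x a) = [exists i, P i].
Proof.
move=> aP; rewrite /= sum_nat_eq0 negb_forall.
by under eq_existsb do rewrite implyTb aP nat_of_bool_neq0; case: [exists _, _].
Qed.

Lemma eval_mul z a b A B :
  (forall i : 'I_n, eval n K T (upd env z i) a = A) ->
  (forall i : 'I_n, eval n K T (upd env z i) b = B) ->
  A <= n -> eval n K T env (mul_expr z a b) = A * B.
Proof.
move=> aA bB An; transitivity (\sum_(i < n) if i < A then B else 0).
  rewrite eval_sum; apply: eq_bigr => i _.
  by rewrite eval_cond eval_lt aA bB nat_of_bool_neq0 /= upd_same.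
by rewrite -big_mkcond -(big_ord_widen n (fun=> B) An) sum_nat_const card_ord.
Qed.

Lemma eval_card z a (A : {set 'I_n}) :
  (forall i : 'I_n, eval n K T (upd env z i) a = (i \in A)) ->
  eval n K T env (Sum z a) = #|A|.
Proof.
by move=> aA; rewrite eval_sum -sum_nat_of_bool; apply: eq_bigr => i _; apply: aA.
Qed.

Lemma eval_rank z a x (A : {set 'I_n}) (u : 'I_n) :
  (forall i : 'I_n, eval n K T (upd env z i) a = (i \in A)) ->
  x != z -> env x = u -> eval n K T env (rank_expr z a x) = rank A u.
Proof.
move=> aA /eqP xz env_x; apply: eval_card => i.
by rewrite eval_and eval_lt aA !nat_of_bool_neq0 inE /= upd_same upd_other // env_x.
Qed.

Definition stores (k : nat) (R : rel 'I_n) : Prop := forall i j : 'I_n, T k i j = R i j.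

Lemma eval_degree z k x R (u : 'I_n) :
  stores k R -> x != z -> env x = u -> eval n K T env (degree_expr z k x) = #|R u|.
Proof.
move=> TR /eqP xz env_x; rewrite -sum_nat_of_bool; apply: eq_bigr => v _ /=.
by rewrite upd_same upd_other // env_x TR.
Qed.

End EvalBinders.

Lemma eval_arcs n K T env y z k (R : rel 'I_n) :
  stores T k R -> y != z -> eval n K T env (arcs_expr y z k) = arcs R.
Proof.
move=> TR yz; rewrite eval_sum; apply: eq_bigr => u _.
by rewrite (eval_degree _ (u := u) TR) ?upd_same.
Qed.

Definition evalE := (eval_cond, eval_plus, eval_lt, eval_and, eval_or, eval_not, eval_eq,
  nat_of_bool_neq0).

Notation graph_table := 0 (only parsing).
Notation sparse_table := 1 (only parsing).
Notation copy_table := 2 (only parsing).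
Notation kept_table := 3 (only parsing).       (* constant along rows *)
Notation rep_table := 4 (only parsing).
Notation merged_adj_table := 5 (only parsing).

Definition par_expr : expr := VertexCount - Budget.

(* [a] times the [m]-th power of the parameter; binds the variables from [z] on. *)
Fixpoint par_power_expr (z m a : nat) : expr :=
  if m is m'.+1 then mul_expr z par_expr (par_power_expr z.+1 m' a) else Lit a.

Definition greedy_expr : expr :=
  Cond (Get graph_table 0 1
        && ((degree_expr 4 sparse_table 0 < par_power_expr 4 2 4)
        && ((degree_expr 4 sparse_table 1 < par_power_expr 4 2 4)
        && (arcs_expr 4 5 sparse_table < par_power_expr 4 4 16))))
    (Get sparse_table 2 3
     || ((Var 2 == Var 0) && (Var 3 == Var 1) || (Var 2 == Var 1) && (Var 3 == Var 0)))
    (Get sparse_table 2 3).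

Definition isolated_expr (z x : nat) : expr := ~~ degree_expr z graph_table x.

Definition kept_expr : expr :=
  degree_expr 2 sparse_table 0
  || ((Var 0 < par_expr)
  || isolated_expr 2 0 && (rank_expr 2 (isolated_expr 3 2) 0 < par_expr)).

Definition kept_nbr_expr (z : nat) : expr := Get kept_table z z && Get graph_table 0 z.

Definition rep_expr : expr :=
  Cond (Get kept_table 0 0) (Var 1 == Var 0)
    (Cond (Sum 2 (kept_nbr_expr 2))
      (kept_nbr_expr 1 && ~~ rank_expr 2 (kept_nbr_expr 2) 1)
      (Var 1 == Lit 0)).

Definition merged_adj_expr : expr :=
  ~~ (Var 0 == Var 1)
  && exists_expr 2 (exists_expr 3
       (Get rep_table 2 0 && (Get rep_table 3 1 && Get graph_table 2 3))).

Definition card_kept_expr (z : nat) : expr := Sum z (Get kept_table z z).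

Definition kept_rank_expr (z x : nat) : expr := rank_expr z (Get kept_table z z) x.

(* The kernel occupies the first cells of table 0, with rows of the length of the
   kernel: cell [i * n + j] holds the adjacency of the vertices of ranks [a] and [b]
   with [i * n + j = a * #|kept| + b]. *)
Definition output_expr : expr :=
  Sum 2 (Sum 3 (Cond
    (Get kept_table 2 2 && (Get kept_table 3 3
     && (mul_expr 4 (kept_rank_expr 5 2) (card_kept_expr 5) + kept_rank_expr 4 3
         == mul_expr 4 (Var 0) VertexCount + Var 1)))
    (Get merged_adj_table 2 3) (Lit 0))).

Definition budget_expr : expr := card_kept_expr 0 - par_expr.

Definition length_expr : expr :=
  mul_expr 0 (card_kept_expr 1) (card_kept_expr 1) + Lit 2.

Definition greedy_cmd : cmd :=
  Then (Tabulate sparse_table 0 1 (Lit 0))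
    (For 0 (For 1 (Then (Tabulate copy_table 2 3 greedy_expr)
                        (Tabulate sparse_table 2 3 (Get copy_table 2 3))))).

Definition kernel_cmd : cmd :=
  Then greedy_cmd
  (Then (Tabulate kept_table 0 1 kept_expr)
  (Then (Tabulate rep_table 0 1 rep_expr)
  (Then (Tabulate merged_adj_table 0 1 merged_adj_expr)
        (Tabulate graph_table 0 1 output_expr)))).

Section KernelProgram.

Variables (n K : nat) (G : sgraph 'I_n).
Let p := n - K.

Lemma exec_Then env c1 c2 T :
  exec n K env (Then c1 c2) T = exec n K env c2 (exec n K env c1 T).
Proof. by []. Qed.

Lemma exec_For env x c T : exec n K env (For x c) T =
  foldl (fun T (i : 'I_n) => exec n K (upd env x i) c T) T (enum 'I_n).
Proof. exact: iteri_foldl. Qed.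

Lemma stores_tabulate env k x y e T (R : rel 'I_n) :
  (forall i j : 'I_n, eval n K T (upd (upd env x i) y j) e = R i j) ->
  stores (exec n K env (Tabulate k x y e) T) k R.
Proof. by move=> eR i j; rewrite /= eqxx eR. Qed.

Lemma stores_tabulate_other env k x y e T k' (R : rel 'I_n) :
  k' != k -> stores T k' R -> stores (exec n K env (Tabulate k x y e) T) k' R.
Proof. by move=> /negbTE kk' TR i j; rewrite /= kk' TR. Qed.

Lemma eval_par_power T env z m a : eval n K T env (par_power_expr z m a) = a * p ^ m.
Proof.
elim: m z env => [|m IH] z env; first by rewrite /= muln1.
by rewrite (@eval_mul _ _ _ _ _ _ _ p (a * p ^ m)) ?leq_subr // expnS mulnCA.
Qed.

Lemma eval_greedy T H (u v i j : 'I_n) env :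
  stores T graph_table (adj G) -> stores T sparse_table H ->
  eval n K T (upd (upd (upd (upd env 0 u) 1 v) 2 i) 3 j) greedy_expr =
  greedy_step G (deg_cap p) (arc_cap p) H (u, v) i j.
Proof.
move=> TG TH; rewrite /greedy_expr !evalE !eval_par_power.
rewrite (eval_degree _ (u := u) TH) // (eval_degree _ (u := v) TH) //.
rewrite (eval_arcs _ _ TH) //.
rewrite /upd /= TG !TH !nat_of_bool_neq0 /greedy_step /=.
by case: ifP.
Qed.

Lemma stores_greedy T : stores T graph_table (adj G) ->
  stores (exec n K (fun=> 0) greedy_cmd T) graph_table (adj G) /\
  stores (exec n K (fun=> 0) greedy_cmd T) sparse_table (sparse p G).
Proof.
move=> TG; pose R T (H : rel 'I_n) :=
  stores T graph_table (adj G) /\ stores T sparse_table H.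
rewrite -[_ /\ _]/(R _ _) /greedy_cmd exec_Then exec_For.
rewrite /sparse /greedy foldl_allpairs; apply: (foldl_rel (R := R)); last first.
  by split; [apply: stores_tabulate_other|apply: stores_tabulate].
move=> {TG}T H u TH; rewrite exec_For.
apply: (foldl_rel (R := R)) => // {TH}T {}H v [TG TH].
split; first by do 2! apply: stores_tabulate_other => //.
by apply: stores_tabulate => i j; apply: eval_greedy.
Qed.

Lemma eval_kept T (i j : 'I_n) env :
  stores T graph_table (adj G) -> stores T sparse_table (sparse p G) ->
  eval n K T (upd (upd env 0 i) 1 j) kept_expr = (i \in kept p G).
Proof.
move=> TG TS; rewrite /kept_expr /isolated_expr !evalE.
rewrite (eval_degree _ (u := i) TS) // (eval_degree _ (u := i) TG) //.
rewrite (@eval_rank _ _ _ _ _ _ _ (isolated G) i) // => [|y].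
  by rewrite !inE lt0n.
by rewrite evalE (eval_degree _ (u := y) TG) // inE.
Qed.

Notation stores_kept T := (stores T kept_table (fun x _ => x \in kept p G)).

Lemma eval_kept_nbr T (env : nat -> nat) x (i z : 'I_n) :
  stores T graph_table (adj G) -> stores_kept T -> env 0 = i -> env x = z ->
  eval n K T env (kept_nbr_expr x) = (z \in kept_nbrs p G i).
Proof.
move=> TG TK env_0 env_x; rewrite /kept_nbr_expr evalE /= env_0 env_x TG TK.
by rewrite !nat_of_bool_neq0 [in RHS]inE.
Qed.

Lemma eval_rep T (i j : 'I_n) env :
  stores T graph_table (adj G) -> stores_kept T ->
  eval n K T (upd (upd env 0 i) 1 j) rep_expr = (rep p G i == j).
Proof.
move=> TG TK; have nbr_j : eval n K T (upd (upd env 0 i) 1 j) (kept_nbr_expr 1) =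
    (j \in kept_nbrs p G i) by apply: eval_kept_nbr.
have nbrs (z : 'I_n) : eval n K T (upd (upd (upd env 0 i) 1 j) 2 z) (kept_nbr_expr 2) =
    (z \in kept_nbrs p G i) by apply: eval_kept_nbr.
rewrite /rep_expr !(nbr_j, evalE) (eval_card nbrs) (eval_rank nbrs (u := j)) //.
rewrite /upd /= TK !nat_of_bool_neq0 eq_rep.
by case: ifP => // _; case: ifP.
Qed.

Lemma eval_merged_adj T (i j : 'I_n) env :
  stores T graph_table (adj G) -> stores T rep_table (fun x y => rep p G x == y) ->
  eval n K T (upd (upd env 0 i) 1 j) merged_adj_expr = merged_adj p G i j.
Proof.
move=> TG TM; rewrite /merged_adj_expr eval_and eval_not eval_eq.
rewrite (eval_exists (P := fun x =>
  [exists y, [&& rep p G x == i, rep p G y == j & adj G x y]])) => [|x].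
  by rewrite !nat_of_bool_neq0 /upd /= eqb0.
apply: eval_exists => y; rewrite !evalE /upd /= TG !TM.
by rewrite !nat_of_bool_neq0.
Qed.

Lemma eval_card_kept T env z :
  stores_kept T -> eval n K T env (card_kept_expr z) = #|kept p G|.
Proof. by move=> TK; apply: eval_card => i; rewrite /= upd_same TK. Qed.

Lemma eval_kept_rank T (env : nat -> nat) z x (u : 'I_n) :
  stores_kept T -> x != z -> env x = u ->
  eval n K T env (kept_rank_expr z x) = rank (kept p G) u.
Proof. by move=> TK; apply: eval_rank => i; rewrite /= upd_same TK. Qed.

Lemma eval_length T env : stores_kept T ->
  eval n K T env length_expr = #|kept p G| * #|kept p G| + 2.
Proof.
move=> TK; rewrite eval_plus; congr (_ + _).
by apply: eval_mul (card_kept_leq_order p G) => i; apply: eval_card_kept.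
Qed.

Lemma eval_output T (i j : 'I_n) env (a b : 'I_#|kept p G|) :
  stores_kept T -> stores T merged_adj_table (merged_adj p G) ->
  i * n + j = a * #|kept p G| + b ->
  eval n K T (upd (upd env 0 i) 1 j) output_expr = adj (kernel p G) a b.
Proof.
move=> TK TA ij; rewrite eval_sum.
transitivity (\sum_(u < n) \sum_(v < n) if (u, v) == (enum_val a, enum_val b)
    then merged_adj p G u v : nat else 0); last first.
  by rewrite pair_bigA -big_mkcond (big_pred1 (enum_val a, enum_val b)) => // -[u v].
apply: eq_bigr => u _; rewrite eval_sum; apply: eq_bigr => v _.
set env' := upd (upd (upd (upd env 0 i) 1 j) 2 u) 3 v.
have index_uv : eval n K T env'
    (mul_expr 4 (kept_rank_expr 5 2) (card_kept_expr 5) + kept_rank_expr 4 3)%expr =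
    rank (kept p G) u * #|kept p G| + rank (kept p G) v.
  rewrite eval_plus (eval_kept_rank (u := v) TK) //; congr (_ + _).
  apply: eval_mul (rank_leq_order _ _) => k; last exact: eval_card_kept.
  exact: eval_kept_rank.
have index_ij : eval n K T env' (mul_expr 4 (Var 0) VertexCount + Var 1)%expr = i * n + j.
  by rewrite eval_plus (@eval_mul _ _ _ _ _ _ _ i n) // ltnW.
rewrite eval_cond eval_and eval_and eval_eq index_uv index_ij !nat_of_bool_neq0.
rewrite /env' /upd /= !TK TA !nat_of_bool_neq0 ij xpair_eqE.
have [ku|/negP ku] := boolP (u \in kept p G); last first.
  by case: (u =P enum_val a) ku => // -> []; apply: enum_valP.
have [kv|/negP kv] := boolP (v \in kept p G); last first.
  by case: (v =P enum_val b) kv => [-> []|]; [apply: enum_valP|rewrite andbF].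
by rewrite eq_rank_pair.
Qed.

Lemma kernel_cmd_correct T0 : stores T0 graph_table (adj G) ->
  let T := exec n K (fun=> 0) kernel_cmd T0 in
  stores_kept T /\ forall (i j : 'I_n) (a b : 'I_#|kept p G|),
    i * n + j = a * #|kept p G| + b -> T graph_table i j = adj (kernel p G) a b.
Proof.
move=> T0G; rewrite /kernel_cmd exec_Then.
have := stores_greedy T0G; set T1 := exec _ _ _ greedy_cmd _ => -[T1G T1S].
rewrite exec_Then; set T2 := exec _ _ _ (Tabulate kept_table _ _ _) _.
have T2G : stores T2 graph_table (adj G) by apply: stores_tabulate_other.
have T2K : stores_kept T2 by apply: stores_tabulate => i j; apply: eval_kept.
rewrite exec_Then; set T3 := exec _ _ _ (Tabulate rep_table _ _ _) _.
have T3G : stores T3 graph_table (adj G) by apply: stores_tabulate_other.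
have T3K : stores_kept T3 by apply: stores_tabulate_other.
have T3M : stores T3 rep_table (fun x y => rep p G x == y).
  by apply: stores_tabulate => i j; apply: eval_rep.
rewrite exec_Then; set T4 := exec _ _ _ (Tabulate merged_adj_table _ _ _) _.
have T4K : stores_kept T4 by apply: stores_tabulate_other.
have T4A : stores T4 merged_adj_table (merged_adj p G).
  by apply: stores_tabulate => i j; apply: eval_merged_adj.
split=> [|i j a b ij]; first exact: stores_tabulate_other.
exact: (eval_output (fun=> 0) T4K T4A ij).
Qed.

End KernelProgram.

Definition kernelize (x : instance) : instance :=
  let p := order x - budget x in
  Instance (kernel p (graph x)) (#|kept p (graph x)| - p).

Lemma kernelize_poly_time : poly_time kernelize.
Proof.
apply: (@table_machine_poly_time kernel_cmd (card_kept_expr 0) budget_expr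
  length_expr) => // x.
set n := order x; set K := budget x; set G := graph x; set N := #|kept (n - K) G|.
have input_graph : stores (input_tables x) graph_table (adj G).
  by move=> i j; rewrite /input_tables /cell mul0n nth_encode_adj.
have [out_kept out_adj] := kernel_cmd_correct K input_graph.
have NE : output_value kernel_cmd (card_kept_expr 0) x = N by apply: eval_card_kept.
split.
- exact: NE.
- by rewrite -[LHS]/(output_value kernel_cmd (card_kept_expr 0) x - (n - K)) NE.
- by rewrite size_encode; apply: eval_length.
- exact: card_kept_leq_order.
move=> i j lti ltj; rewrite -[order (kernelize x)]/N => lt_NN.
have N_gt0 : 0 < N by case: (N) lt_NN => //; rewrite muln0.
have lt_a : (i * n + j) %/ N < N by rewrite ltn_divLR.
have lt_b : (i * n + j) %% N < N by rewrite ltn_mod.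
have := nth_encode_adj (x := kernelize x) (Ordinal lt_a) (Ordinal lt_b).
rewrite /= -divn_eq => ->.
apply: (out_adj (Ordinal lti) (Ordinal ltj) (Ordinal lt_a) (Ordinal lt_b)).
exact: divn_eq.
Qed.

Lemma kernelize_target b x :
  identifiable (target b) (budget x) (graph x) <->
  identifiable (target b) (budget (kernelize x)) (graph (kernelize x)).
Proof.
rewrite /=; set p := order x - budget x; set N := #|_|.
have [large_budget|small_budget] := leqP (order x) (budget x).
  have p0 : p = 0 by apply/eqP; rewrite subn_eq0.
  by split=> _; apply: identifiable_large_budget; rewrite card_ord // p0 subn0.
have p_gt0 : 0 < p by rewrite subn_gt0.
have pN : p <= N by apply: card_kept_ge; rewrite leq_subr.
rewrite !identifiable_iff_cluster_map ?card_ord ?subKn //; last by lia.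
exact: has_cluster_map_kernel.
Qed.

Lemma order_kernelize_le x :
  order (kernelize x) <= 18 * (`|order_minus_budget x|%N ^ 4).+1.
Proof.
set q := `|_|%N; rewrite /=; set p := order x - budget x.
have pq : p <= q by rewrite /p /q /order_minus_budget; lia.
have p4q4 : p ^ 4 <= q ^ 4 by rewrite leq_exp2r.
have p_le : p <= p ^ 4 by case: (p) => // m; rewrite expnS leq_pmulr // expn_gt0.
by apply: leq_trans (card_kept_le _ _) _; rewrite /arc_cap; lia.
Qed.

Lemma order_minus_budget_kernelize_le x :
  `|order_minus_budget (kernelize x)|%N <= `|order_minus_budget x|%N.
Proof.
rewrite /order_minus_budget /=; set p := order x - budget x; set N := #|_|.
have pN : p <= N by apply: card_kept_ge; rewrite leq_subr.
by rewrite /p in pN *; lia.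
Qed.

Lemma identifiable_admits_kernel b :
  admits_kernel (fun x => identifiable (target b) (budget x) (graph x))
    order_minus_budget (fun p => p ^ 4).
Proof.
exists kernelize; split.
- exact: kernelize_poly_time.
- exact: kernelize_target.
- by exists 18; apply: order_kernelize_le.
- by exists (fun z => `|z|%N); apply: order_minus_budget_kernelize_le.
Qed.

Theorem theorem4p6 :
  admits_kernel clique_identification order_minus_budget (fun p => p ^ 4) /\
  admits_kernel cluster_identification order_minus_budget (fun p => p ^ 4).
Proof.
split.
- exact: (identifiable_admits_kernel true).
- exact: (identifiable_admits_kernel false).
Qed.
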